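(* Let $n\ge 2$ and let $M\in \mathrm{GL}(n,\mathbb{Z})$ be simple, i.e. $M$ has no repeated eigenvalues in $\mathbb{C}$. Let $P(x)=\det(x\mathbf{1}-M)$ be its characteristic polynomial and write $P(x)=\prod_{i=1}^{\ell}P_i(x)$ with $P_i(x)\in\mathbb{Z}[x]$ monic and irreducible over $\mathbb{Z}$. Then the symmetry group $\mathcal{S}(M)=\{G\in \mathrm{GL}(n,\mathbb{Z}) : MG=GM\}$ is a finitely generated Abelian group of the form $$\mathcal{S}(M)\;\simeq\; T\times\mathbb{Z}^r ,$$ where $T$ is a finite Abelian group of even order that can be generated by at most $\ell$ elements. Furthermore, if $P_i(x)$ has $n_1^{(i)}$ real roots and $n_2^{(i)}$ pairs of complex conjugate (non-real) roots, then the rank $r$ is given by $$r\;=\;\sum_{i=1}^{\ell}\bigl(n_1^{(i)}+n_2^{(i)}-1\bigr).$$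
   Context: $\mathrm{GL}(n,\mathbb{Z})$ is the group of integer $n\times n$ matrices with determinant $\pm1$, and $\mathbf{1}$ is the identity matrix. *)

(* Defs.v *)
From HB Require Import structures.
From mathcomp Require Import all_boot all_order all_fingroup all_algebra.
From mathcomp Require Import classical_sets cardinality reals.
From mathcomp Require Import complex.

Set Implicit Arguments.
Unset Strict Implicit.
Unset Printing Implicit Defensive.

Import Order.TTheory GRing.Theory Num.Theory.
Local Open Scope classical_set_scope.
Local Open Scope card_scope.
Local Open Scope ring_scope.

Record GLZ (n : nat) := MkGLZ {
  GLZmx :> 'M[int]_n;
  _ : (\det GLZmx == 1) || (\det GLZmx == -1) }.

HB.instance Definition _ n := [isSub for @GLZmx n].
HB.instance Definition _ n := [Choice of GLZ n by <:].

Section GLZGroup.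
Variable n : nat.
Implicit Types A B : 'M[int]_n.

Lemma GLZ_unitmx (A : GLZ n) : (A : 'M_n) \in unitmx.
Proof. by rewrite unitmxE; case: A => A /= /orP[] /eqP ->. Qed.

Lemma GLZ_one_subproof : (\det (1%:M : 'M[int]_n) == 1)
  || (\det (1%:M : 'M[int]_n) == -1).
Proof. by rewrite det1 eqxx. Qed.

Lemma GLZ_mul_subproof (A B : GLZ n) :
  (\det (A *m B) == 1) || (\det (A *m B) == -1).
Proof.
by rewrite det_mulmx; case: A B => [A /= /orP[] /eqP ->] [B /= /orP[] /eqP ->].
Qed.

Lemma GLZ_inv_subproof (A : GLZ n) :
  (\det (invmx A) == 1) || (\det (invmx A) == -1).
Proof. by rewrite det_inv; case: A => A /= /orP[] /eqP ->. Qed.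

Definition GLZ_one : GLZ n := MkGLZ GLZ_one_subproof.
Definition GLZ_mul (A B : GLZ n) : GLZ n := MkGLZ (GLZ_mul_subproof A B).
Definition GLZ_inv (A : GLZ n) : GLZ n := MkGLZ (GLZ_inv_subproof A).

Lemma GLZ_mulA : associative GLZ_mul.
Proof. by move=> A B C; apply: val_inj; rewrite /= mulmxA. Qed.
Lemma GLZ_mul1r : left_id GLZ_one GLZ_mul.
Proof. by move=> A; apply: val_inj; rewrite /= mul1mx. Qed.
Lemma GLZ_mulr1 : right_id GLZ_one GLZ_mul.
Proof. by move=> A; apply: val_inj; rewrite /= mulmx1. Qed.
Lemma GLZ_mulVr : left_inverse GLZ_one GLZ_inv GLZ_mul.
Proof. by move=> A; apply: val_inj; rewrite /= mulVmx ?GLZ_unitmx. Qed.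
Lemma GLZ_mulrV : right_inverse GLZ_one GLZ_inv GLZ_mul.
Proof. by move=> A; apply: val_inj; rewrite /= mulmxV ?GLZ_unitmx. Qed.

HB.instance Definition _ :=
  isGroup.Build (GLZ n) GLZ_mulA GLZ_mul1r GLZ_mulr1 GLZ_mulVr GLZ_mulrV.

End GLZGroup.

Section SymmetryGroup.
Variables (n : nat) (M : GLZ n).

Definition commutes_with : {pred GLZ n} := [pred G | (M * G == G * M)%g].

Record symmetry_group := MkSymmetry {
  symval :> GLZ n;
  _ : symval \in commutes_with }.

HB.instance Definition _ := [isSub for symval].
HB.instance Definition _ := [Choice of symmetry_group by <:].

Lemma commutes_with_group_closed : group_closed commutes_with.
Proof.
split=> [|A B]; rewrite !inE; first by rewrite mulg1 mul1g.
by move=> /eqP MA /eqP MB; apply/eqP/commuteM => //; apply: commuteV.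
Qed.

HB.instance Definition _ := SubChoice_isSubGroup.Build (GLZ n) commutes_with
  symmetry_group commutes_with_group_closed.

End SymmetryGroup.

Definition simple_mx (R : realType) (n : nat) (M : 'M[int]_n) : Prop :=
  let MC : 'M[R[i]]_n := map_mx intr M in
  forall z : R[i], eigenvalue MC z -> mup z (char_poly MC) = 1%N.

(* The library's [irreducible_poly] uses pseudo-division, hence describes
   irreducibility over the fraction field; this is irreducibility in the
   ring [R] itself. *)
Definition irreducible_elt (R : unitRingType) (p : R) : Prop :=
  [/\ p != 0, p \isn't a GRing.unit
    & forall q r : R, p = q * r -> q \is a GRing.unit \/ r \is a GRing.unit].

(* Roots are counted without multiplicity, which is immaterial for an
   irreducible polynomial over the integers. *)
Definition has_real_roots (R : realType) (p : {poly int}) (k : nat) : Prop :=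
  [set x : R | root (map_poly intr p) x] #= `I_k.

(* Each pair of conjugate non-real roots is the set {z, conjc z}. *)
Definition has_conj_pairs (R : realType) (p : {poly int}) (k : nat) : Prop :=
  [set E : set R[i] | exists z : R[i],
      [/\ root (map_poly intr p) z, complex.Im z != 0%R
        & E = [set z; conjc z]]] #= `I_k.

Definition finitely_generated (G : groupType) : Prop :=
  exists s : seq G, forall x : G, exists w : seq G,
    (forall y, y \in w -> y \in s \/ (y^-1)%g \in s) /\
    x = (\prod_(y <- w) y)%g.

(* [A] is written additively, [G] multiplicatively. *)
Definition add_mul_isomorphic (A : zmodType) (G : groupType) : Prop :=
  exists f : A -> G, bijective f /\ forall a b, f (a + b) = (f a * f b)%g.

(* The finite abelian group [T] is written additively; [<<A>>] is the subgroup
   generated by [A] for this additive law. *)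
Definition generated_by_at_most (T : finZmodType) (k : nat) : Prop :=
  exists A : {set T}, (#|A| <= k)%N /\ <<A>>%g = [set: T]%SET.

(* Main.v *)
Require Import Defs.
From HB Require Import structures.
From mathcomp Require Import all_boot all_order all_fingroup all_algebra.
From mathcomp Require Import classical_sets cardinality reals.
From mathcomp Require Import complex.
From mathcomp Require Import cyclic boolp sequences exp ring lra zify.

Set Implicit Arguments.
Unset Strict Implicit.
Unset Printing Implicit Defensive.

Import Order.TTheory GRing.Theory Num.Theory.
Import ComplexField.
Local Open Scope ring_scope.

(** Diagonalizing [M] over the complex numbers sends a matrix [G] commuting with
    [M] to the tuple of its eigenvalues, indexed by the roots of the
    characteristic polynomial; a fixed multiple of [G] is an integer polynomial
    in [M].  Within the block of roots of a factor [P_i], the eigenvalues of [G]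
    come in conjugate pairs, are all [1] as soon as one is, and have a product of
    modulus [1] when [G] is invertible.  Keeping one root from each conjugate
    pair and dropping one of these from each block, the logarithms of the moduli
    of the eigenvalues define a morphism to R^r with finite preimages of bounded
    sets.  The pigeonhole principle produces, for every kept root, a unit with
    eigenvalue [1] outside the block of that root and with modulus less than [1]
    at the other roots of the block; their logarithms form a diagonally dominant
    matrix, so the image is a lattice of rank r.  The kernel T embeds into a
    product of l multiplicative groups of fields, one root per block, whence its l
    generators; and [- 1] is an element of order 2 in T. *)

(** * Subgroups with a discrete image of full rank *)

(** Cofactor expansion along row [i0]: the cofactors of that row do not involve its entries, so they
    are those of [W]. *)
Lemma det_replace_row (K : comPzRingType) n (W : 'M[K]_n) (y : 'rV_n) i0 :
  \det (\matrix_i (if i == i0 then y else row i W)) = (y *m \adj W) 0 i0.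
Proof.
rewrite (expand_det_row _ i0) mxE; apply: eq_bigr => j _.
rewrite !mxE eqxx; congr (_ * _); rewrite /cofactor; congr (_ * \det _).
by apply/matrixP=> a b; rewrite !mxE eq_sym (negPf (neq_lift _ _)) mxE.
Qed.

Lemma pigeonhole_seq (T : eqType) (s : seq T) (f : nat -> T) :
  (forall t, f t \in s) ->
  exists t t', [/\ (t < t')%N, (t' <= size s)%N & f t = f t'].
Proof.
move=> fs; have : ~~ uniq (mkseq f (size s).+1).
  apply/negP => /uniq_leq_size h; have := h s; rewrite size_mkseq ltnn => {}h.
  by have // : false by apply: h => _ /mapP[t _ ->].
case/(uniqPn (f 0)) => t [t' [tt' ]]; rewrite size_mkseq => t's.
by rewrite !nth_mkseq ?(ltn_trans tt' t's) //; exists t, t'.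
Qed.

Section Lattice.
Variables (R : realType) (A : zmodType) (r : nat) (L : {additive A -> 'rV[R]_r}).
Hypothesis L_fin : forall B : R, exists s : seq A,
  forall x, (forall k, `|L x 0 k| <= B) -> x \in s.

Definition zlincomb (v : 'I_r -> A) (q : 'rV[int]_r) : A := \sum_i v i *~ q 0 i.

Lemma zlincombD v q q' : zlincomb v (q + q') = zlincomb v q + zlincomb v q'.
Proof. by rewrite -big_split; apply: eq_bigr => i _; rewrite mxE mulrzDr. Qed.

Lemma zlincombN v q : zlincomb v (- q) = - zlincomb v q.
Proof. by rewrite /zlincomb -sumrN; apply: eq_bigr => i _; rewrite mxE mulrNz. Qed.

Lemma L_zlincomb v q :
  L (zlincomb v q) = map_mx intr q *m (\matrix_i L (v i)).
Proof.
rewrite raddf_sum mulmx_sum_row; apply: eq_bigr => i _.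
by rewrite rowK mxE raddfMz scaler_int.
Qed.

Section Independent.
Variable u : 'I_r -> A.
Hypothesis u_free : (\matrix_i L (u i)) \in unitmx.
Local Notation U := (\matrix_i L (u i)).

Let co x := L x *m invmx U.

Let coK x : co x *m U = L x.
Proof. by rewrite /co mulmxKV. Qed.

(* Modulo the lattice spanned by [u], the multiples of [x] fall in a bounded
   set, so two of the first ones coincide. *)
Lemma bounded_denominator : exists N : nat, (0 < N)%N /\
  forall x, exists z : 'rV[int]_r, map_mx intr z = N%:R *: co x.
Proof.
(* This sum bounds every entry of a combination of the rows of [U] with coefficients in [0, 1]. *)
have [s sP] := L_fin (\sum_i \sum_j `|U i j|).
(* The pigeonhole yields a denominator [t' - t] that depends on [x] but is at most [size s]; the
   factorial is a multiple of all of them. *)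
exists ((size s)`!)%N; split=> [|x]; first exact: fact_gt0.
pose q (t : nat) : 'rV[int]_r := \row_i Num.floor (t%:R * co x 0 i).
pose y (t : nat) := x *+ t - zlincomb u (q t).
have ys t : y t \in s.
  apply: sP => k; rewrite raddfB raddfMn /= L_zlincomb -{1}coK -scaler_nat scalemxAl.
  rewrite -mulmxBl mxE (le_trans (ler_norm_sum _ _ _)) //.
  apply: ler_sum => i _; rewrite (bigD1 k) //= -[leLHS]addr0 lerD ?sumr_ge0 //.
  have -> : (t%:R *: co x - map_mx intr (q t)) 0 i
      = t%:R * co x 0 i - (Num.floor (t%:R * co x 0 i))%:~R by rewrite !mxE.
  rewrite mxE normrM ler_piMl //.
  have /andP[h1] := floor_itv (t%:R * co x 0 i); rewrite intrD => h2.
  by rewrite ger0_norm ?subr_ge0 // lerBlDl ltW // addrC.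
have [t [t' [tt' t's yt]]] := pigeonhole_seq ys.
have mx_ge : (t' - t %| (size s)`!)%N.
  by rewrite dvdn_fact // subn_gt0 tt' (leq_trans (leq_subr _ _)).
have [m sE] := dvdnP mx_ge.
exists (m%:R *: (q t' - q t)).
have : L (x *+ (t' - t)) = map_mx intr (q t' - q t) *m U.
  rewrite -L_zlincomb mulrnBr; last exact: ltnW.
  congr (L _); apply/eqP; rewrite -subr_eq0 zlincombD zlincombN opprD addrACA -opprD.
  by rewrite -/(y t) -/(y t') yt subrr.
move/(congr1 (mulmx^~ (invmx U))); rewrite mulmxK // raddfMn -scaler_nat -scalemxAl -/(co x).
by move=> qE; rewrite sE natrM -scalerA qE map_mxZ /= natz.
Qed.

Let intmx_inj m p : injective (map_mx intr : 'M[int]_(m, p) -> 'M[R]_(m, p)).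
Proof.
move=> X Y /matrixP XY; apply/matrixP => i j.
by move: (XY i j); rewrite !mxE => /intr_inj.
Qed.

(* Among the r-tuples whose determinant (in the coordinates given by [u], scaled
   to be integers) is nonzero, one of minimal determinant is a basis: if
   reducing an element modulo the tuple left a nonzero remainder, substituting
   that remainder for a member of the tuple would decrease the determinant. *)
Lemma lattice_basis : exists v : 'I_r -> A,
  (forall q, L (zlincomb v q) = 0 -> q = 0) /\
  forall x, exists q, L (x - zlincomb v q) = 0.
Proof.
have [N [N0 NP]] := bounded_denominator.
have [Z ZP] := choice NP.
have N0' : N%:R != 0 :> R by rewrite pnatr_eq0 -lt0n.
have coD x y : co (x - y) = co x - co y by rewrite /co raddfB mulmxBl.
have ZB x y : Z (x - y) = Z x - Z y.
  by apply: intmx_inj; rewrite map_mxB !ZP coD scalerBr.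
have Z_eq0 x : Z x = 0 -> L x = 0.
  move=> Zx; rewrite -coK; suff -> : co x = 0 by rewrite mul0mx.
  apply/eqP; move: (ZP x); rewrite Zx map_mx0 => /esym/eqP.
  by rewrite scaler_eq0 (negPf N0').
have Z0 x : L x = 0 -> Z x = 0.
  move=> Lx; apply: intmx_inj.
  by rewrite ZP /co Lx mul0mx scaler0 map_mx0.
have Zmz v q : Z (zlincomb v q) = q *m \matrix_i Z (v i).
  apply: intmx_inj; rewrite ZP /co L_zlincomb map_mxM.
  rewrite -mulmxA scalemxAr; congr (_ *m _).
  by apply/row_matrixP => i; rewrite -map_row rowK ZP linearZ /= row_mul rowK.
pose Dt (v : 'I_r -> A) := \det (\matrix_i Z (v i)).
pose Pd d := `[< exists v, Dt v != 0 /\ absz (Dt v) = d >].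
have exP : exists d, Pd d.
  (* The tuple [u] qualifies: its scaled coordinates form [N] times the identity. *)
  exists (absz (Dt u)); apply/asboolP; exists u; split=> //.
  rewrite -(intr_eq0 R) -det_map_mx.
  suff -> : map_mx intr (\matrix_i Z (u i)) = N%:R%:M :> 'M[R]_r.
    by rewrite det_scalar expf_neq0.
  apply/row_matrixP => i; rewrite -map_row rowK ZP /co -[L _](rowK (fun i => L (u i))).
  rewrite -row_mul mulmxV //; apply/rowP => j; rewrite !mxE mulr_natr mulrb.
  by case: eqP => _; rewrite ?mulr1 ?mulr0.
case: (ex_minnP exP) => d /asboolP [v [v0 vd]] dmin.
set W := \matrix_i Z (v i) in v0 vd *; rewrite /Dt -/W in v0 vd.
exists v; split=> [q|x].
  move/Z0; rewrite Zmz -/W => /(congr1 (mulmx^~ (\adj W))).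
  rewrite -mulmxA mul_mx_adj mul0mx mul_mx_scalar => /eqP.
  by rewrite scalemx_eq0 (negPf v0) => /eqP.
have [a aE] : exists a, Z x *m \adj W = a by exists (Z x *m \adj W).
(* [a] is [\det W] times the coordinates of [x] relative to [v]; entrywise Euclidean division leaves
   remainders smaller than the determinant in absolute value. *)
pose q : 'rV[int]_r := \row_i (a 0%R i %/ \det W)%Z.
exists q; set x' := x - _; apply: Z_eq0.
have a'E : Z x' *m \adj W = \row_i (a 0%R i %% \det W)%Z.
  rewrite ZB Zmz -/W mulmxBl aE -mulmxA mul_mx_adj mul_mx_scalar.
  apply/rowP => i; rewrite !mxE {1}(divz_eq (a 0 i) (\det W)) mulrC.
  by rewrite addrC addKr.
suff r0 : Z x' *m \adj W = 0.
  apply/eqP; move/(congr1 (mulmx^~ W))/eqP: r0; rewrite mul0mx -mulmxA mul_adj_mx.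
  by rewrite mul_mx_scalar scalemx_eq0 (negPf v0).
apply/rowP => i; rewrite a'E !mxE; apply/eqP/negPn/negP => m0.
pose v' j := if j == i then x' else v j.
have Dv' : Dt v' = (a 0%R i %% \det W)%Z.
  have <- : (Z x' *m \adj W) 0 i = (a 0%R i %% \det W)%Z by rewrite a'E mxE.
  rewrite -det_replace_row; congr (\det _); apply/row_matrixP => j; rewrite !rowK /v'.
  by case: eqP.
have := dmin (absz (Dt v')); rewrite leqNgt => /(_ _)/negP; apply.
  by apply/asboolP; exists v'; rewrite Dv'.
by rewrite -vd -ltz_nat Dv' gez0_abs ?modz_ge0 // ltz_mod.
Qed.
End Independent.

(** [L_fin] with bound 0 confines the kernel to a finite list, whose elements then carry the finite
    group. *)
Lemma kernel_finZmodType : exists (T : finZmodType) (io : T -> A),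
  [/\ injective io, {morph io : a b / a + b} &
      forall x, L x = 0 <-> exists t, x = io t].
Proof.
have [s sP] := L_fin 0.
pose K := [seq x <- s | L x == 0].
have KP x : (x \in K) = (L x == 0).
  rewrite mem_filter; case: eqP => //= Lx; apply: sP => k.
  by rewrite Lx mxE normr0.
have K0 : 0 \in K by rewrite KP raddf0.
have KD x y : x \in K -> y \in K -> x + y \in K.
  by rewrite !KP raddfD => /eqP -> /eqP ->; rewrite addr0.
have KN x : x \in K -> - x \in K by rewrite !KP raddfN oppr_eq0.
pose add (a b : seq_sub K) := SeqSub (KD _ _ (valP a) (valP b)).
pose opp (a : seq_sub K) := SeqSub (KN _ (valP a)).
have addA : associative add by move=> a b c; apply/val_inj/addrA.
have addC : commutative add by move=> a b; apply/val_inj/addrC.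
have add0 : left_id (SeqSub K0) add by move=> a; apply/val_inj/add0r.
have addN : left_inverse (SeqSub K0) opp add by move=> a; apply/val_inj/addNr.
pose T : finZmodType :=
  HB.pack (seq_sub K) (GRing.isZmodule.Build (seq_sub K) addA addC add0 addN).
exists T, (val : seq_sub K -> A); split=> // [|x]; first exact: val_inj.
split=> [Lx|[t ->]]; last by apply/eqP; rewrite -KP (valP t).
have xK : x \in K by rewrite KP Lx.
by exists (SeqSub xK).
Qed.

(** The image is free on the [L (v i)], so lifting this basis to the [v i] splits [A] as kernel plus
    lattice. *)
Lemma lattice_structure (u : 'I_r -> A) : (\matrix_i L (u i)) \in unitmx ->
  exists (T : finZmodType) (io : T -> A) (v : 'I_r -> A),
  [/\ injective io, {morph io : a b / a + b},
      forall x, L x = 0 <-> exists t, x = io t &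
      bijective (fun p : T * 'rV[int]_r => io p.1 + zlincomb v p.2)].
Proof.
move=> u_free; have [T [io [io_inj ioD ioP]]] := kernel_finZmodType.
have [v [v_inj v_surj]] := lattice_basis u_free.
exists T, io, v; split=> //.
have Lio t : L (io t) = 0 by apply/ioP; exists t.
have decomp x : exists p : T * 'rV[int]_r, x = io p.1 + zlincomb v p.2.
  have [q /ioP[t /eqP]] := v_surj x.
  by rewrite subr_eq => /eqP ->; exists (t, q).
have [g gP] := choice decomp.
exists g => [[t q]|x]; last by rewrite -gP.
case: (g _) (gP (io t + zlincomb v q)) => t' q' /= E.
have qq' : q' - q = 0.
  apply: v_inj; rewrite zlincombD zlincombN raddfB; apply/eqP.
  have := congr1 L E; rewrite !raddfD !Lio !add0r => ->; exact/eqP/subrr.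
move/eqP: qq' E; rewrite subr_eq0 => /eqP ->.
by move/addIr/io_inj ->.
Qed.
End Lattice.

(** The hypothesis is induction over the subgroup generated by [s]; it is applied to the predicate
    of being a word in [s] and its inverses. *)
Lemma finitely_generated_decomp (G : groupType) (s : seq G) :
  (forall gen : G -> Prop, gen 1%g -> (forall x y, gen x -> gen y -> gen (x * y)%g) ->
     (forall x, gen x -> gen (x^-1)%g) -> (forall x, x \in s -> gen x) -> forall x, gen x) ->
  finitely_generated G.
Proof.
move=> gen_ind; exists s; apply: gen_ind.
- by exists [::]; split; rewrite ?big_nil.
- move=> x y [w [ws ->]] [w' [ws' ->]]; exists (w ++ w'); split; last by rewrite big_cat.
  by move=> z; rewrite mem_cat => /orP[/ws|/ws'].
- move=> x [w [ws ->]]; exists (rev [seq y^-1 | y <- w]%g); split.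
    move=> y; rewrite mem_rev => /mapP[z /ws zs ->]; rewrite invgK.
    by case: zs; [right|left].
  elim: w {ws} => [|y w IH]; first by rewrite !big_nil invg1.
  by rewrite big_cons invgM IH map_cons rev_cons -cats1 big_cat big_seq1.
- move=> x xs; exists [:: x]; split; last by rewrite big_seq1.
  by move=> y; rewrite inE => /eqP ->; left.
Qed.

Lemma log_structure (R : realType) (G : groupType) (r : nat) (L : G -> 'rV[R]_r)
    (u : 'I_r -> G) :
  (forall x y : G, x * y = y * x)%g ->
  (forall x y, L (x * y)%g = L x + L y) ->
  (forall B : R, exists s : seq G, forall x, (forall k, `|L x 0 k| <= B) -> x \in s) ->
  (\matrix_i L (u i)) \in unitmx ->
  finitely_generated G /\
  exists (T : finZmodType) (io : T -> G),
    [/\ add_mul_isomorphic (T * 'rV[int]_r)%type G, injective io,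
        forall a b, io (a + b) = (io a * io b)%g &
        forall x, L x = 0 <-> exists t, x = io t].
Proof.
move=> mulC LM L_fin u_free.
(* The same carrier in additive notation, so that the lattice results apply. *)
pose A : zmodType := HB.pack (G : Type) (Choice.class G)
  (GRing.isZmodule.Build G (@mulgA G) mulC (@mul1g G) (@mulVg G)).
have L0 : L 1%g = 0.
  by apply: (@addrI _ (L 1%g)); rewrite -LM mulg1 addr0.
pose LA : {additive A -> 'rV[R]_r} := HB.pack (L : A -> 'rV[R]_r)
  (GRing.isNmodMorphism.Build A _ (L : A -> 'rV[R]_r) (conj L0 LM)).
have [T [io [v [io_inj ioD ioP f_bij]]]] := @lattice_structure R A r LA L_fin u u_free.
split; last first.
  exists T, io; split=> //; exists (fun p => io p.1 + zlincomb v p.2).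
  split=> // -[t q] [t' q'] /=; rewrite ioD zlincombD.
  exact: (@addrACA A).
apply: (@finitely_generated_decomp G ([seq io t | t <- enum T] ++ [seq v i | i <- enum 'I_r])).
move=> gen gen1 genM genV gens x.
have [g _ gK] := f_bij; rewrite -(gK x); case: (g x) => t q /=.
apply: (genM (io t) (zlincomb v q)); first by apply: gens; rewrite mem_cat map_f ?mem_enum.
rewrite /zlincomb; elim/(@big_ind A): _ => // i _.
have gv : gen (v i) by apply: gens; rewrite mem_cat orbC map_f ?mem_enum.
have gvn m : gen ((v i : A) *+ m).
  by elim: m => // m IH; rewrite mulrS; apply: genM.
by case: (q 0 i) => m; [exact: gvn | apply: genV; exact: gvn].
Qed.

(** * Norms and common roots of integer polynomials *)

Lemma horner_mx_eigen (F : fieldType) n (A : 'M[F]_n.+1) (v : 'rV_n.+1) z f :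
  v *m A = z *: v -> v *m horner_mx A f = f.[z] *: v.
Proof.
move=> vA; elim/poly_ind: f => [|f c IH]; first by rewrite rmorph0 horner0 mulmx0 scale0r.
rewrite rmorphD rmorphM /= horner_mx_X horner_mx_C mulmxDr !hornerE.
rewrite -[horner_mx A f * A]/(horner_mx A f *m A) mulmxA IH -scalemxAl vA.
by rewrite mul_mx_scalar scalerA -scalerDl.
Qed.

Lemma horner_char_poly (F : comNzRingType) n (A : 'M[F]_n) w :
  (char_poly A).[w] = \det (w%:M - A).
Proof.
rewrite -horner_evalE -det_map_mx; congr (\det _); apply/matrixP => i j.
by rewrite !mxE /= /horner_eval hornerD hornerN hornerC hornerMn hornerX.
Qed.

(** Splitting [g] into linear factors reduces to determinants of [A - w%:M], which are values of the
    characteristic polynomial; then the two products are exchanged. *)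
Lemma det_horner_mx (F : closedFieldType) n (A : 'M[F]_n.+1) (rs : seq F) g :
  char_poly A = \prod_(z <- rs) ('X - z%:P) ->
  \det (horner_mx A g) = \prod_(z <- rs) g.[z].
Proof.
move=> Ars; have srs : size rs = n.+1.
  by apply/eqP; rewrite -eqSS -(size_prod_XsubC _ id) -Ars size_char_poly.
have [ws ->] := closed_field_poly_normal g; set c := lead_coef g.
have detw w : \det (A - w%:M) = \prod_(z <- rs) (z - w).
  rewrite -opprB -scaleN1r detZ -horner_char_poly Ars horner_prod -srs -sum1_size.
  rewrite -prodrXr -big_split; apply: eq_bigr => z _ /=.
  by rewrite !hornerE mulN1r opprB.
rewrite linearZ /= detZ rmorph_prod /= (big_morph _ (@det_mulmx _ _) (det1 _ _)).
under [X in _ * X]eq_bigr => w _ do rewrite rmorphB /= horner_mx_X horner_mx_C detw.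
rewrite -srs -sum1_size -prodrXr.
rewrite exchange_big -big_split; apply: eq_bigr => z _ /=.
by rewrite hornerZ horner_prod; congr (_ * _); apply: eq_bigr => w _; rewrite !hornerE.
Qed.

Section Norm.
Variable F : numClosedFieldType.
Local Notation "p ^F" := (map_poly (intr : int -> F) p) (at level 2, format "p ^F").

(* [N] and [h] come from the characteristic polynomial of [g] evaluated at the
   companion matrix of [p]: the constant coefficient of that polynomial is the
   norm of [g] up to sign. *)
Lemma norm_poly (p g : {poly int}) (rs : seq F) :
  p \is monic -> (1 < size p)%N -> p^F = \prod_(z <- rs) ('X - z%:P) ->
  exists (N : int) (h : {poly int}), N%:~R = \prod_(z <- rs) g^F.[z] /\
    forall z, z \in rs -> g^F.[z] * h^F.[z] = N%:~R.
Proof.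
move=> pm sp prs.
have [d [A Ap]] : exists d (A : 'M[int]_d.+1), char_poly A = p.
  (* The companion matrix has dimension [(size p).-1], which must have the form [d.+1]. *)
  exists (size p).-2; move: (companionmx p) (companionmxK pm).
  by case: (size p) sp => [|[|s]] //= _ A pE; exists A.
pose B := horner_mx A g; pose q := char_poly B; pose s : int := (-1) ^+ d.+1.
have [D qD] : exists D, q = (q`_0)%:P + D * 'X.
  exists (drop_poly 1 q); rewrite -{1}[q](poly_take_drop 1); congr (_ + _).
  by apply/polyP => i; rewrite coef_take_poly coefC; case: i.
(* Cayley-Hamilton at an eigenvector for [z] gives [q_0 + D(g(z)) g(z) = 0], where [q_0] is [s]
   times [\det B]; multiplying by the sign [s] isolates the norm. *)
exists (\det B), ((- s) *: (D \Po g)).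
have AF : char_poly (map_mx intr A) = \prod_(z <- rs) ('X - z%:P).
  by rewrite -map_char_poly Ap.
split=> [|z zrs].
  by rewrite -(det_horner_mx _ AF) -map_horner_mx det_map_mx.
have /eigenvalueP[v vA v0] : eigenvalue (map_mx intr A) z.
  by rewrite eigenvalue_root_char AF root_prod_XsubC.
have vB : v *m map_mx intr B = g^F.[z] *: v.
  by rewrite map_horner_mx; apply: horner_mx_eigen.
have := horner_mx_eigen q^F vB.
rewrite -map_horner_mx Cayley_Hamilton map_mx0 mulmx0 => /esym/eqP.
rewrite scaler_eq0 (negPf v0) orbF qD char_poly_det -/s rmorphD /= map_polyC.
rewrite [map_poly _ (_ * _)]rmorphM /= map_polyX !hornerE addrC addr_eq0 mulrC => /eqP qE.
have ss : s * s = 1 by rewrite -expr2 sqrr_sign.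
rewrite linearZ /= map_comp_poly hornerZ horner_comp mulrCA qE.
by rewrite rmorphN mulrNN -rmorphM mulrA ss mul1r.
Qed.

(** The rational gcd vanishes at [z], so it is not constant. Gauss's lemma turns it into an integer
    factor of [p], and irreducibility makes it [p] up to a scalar. *)
Lemma irreducible_root_dvdp (p g : {poly int}) (z : F) :
  p \is monic -> irreducible_elt p -> root p^F z -> root g^F z ->
  map_poly (intr : int -> rat) p %| map_poly (intr : int -> rat) g.
Proof.
move=> pm [_ _ p_irr] pz gz.
pose d := gcdp (map_poly (intr : int -> rat) p) (map_poly (intr : int -> rat) g).
have FE f : map_poly ratr (map_poly (intr : int -> rat) f) = f^F.
  by rewrite -map_poly_comp; apply: eq_map_poly => a /=; rewrite ratr_int.
have dz : root (map_poly ratr d) z by rewrite gcdp_map !FE root_gcd pz.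
have p0 : map_poly (intr : int -> rat) p != 0.
  by rewrite -size_poly_eq0 size_rat_int_poly size_poly_eq0 monic_neq0.
have sd : size d != 1%N.
  apply: contraTneq dz => /eqP/size_poly1P[c c0 ->].
  by rewrite map_polyC rootC fmorph_eq0.
have [p1 [a a0 dE] [r pE]] := dvdpP_rat_int (dvdp_gcdl _ _ : d %| _).
case: (p_irr _ _ pE).
  rewrite poly_unitE => /andP[/eqP s1 _]; move: sd.
  by rewrite dE size_scale // size_rat_int_poly s1.
rewrite poly_unitE => /andP[/eqP s1 _].
have rE : r = (r`_0)%:P by apply: size1_polyC; rewrite s1.
apply: dvdp_trans (dvdp_gcdr _ _ : d %| _).
have r0 : r`_0 != 0.
  by apply: contraNneq p0; move=> r0; rewrite pE rE r0 mulr0 rmorph0.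
by rewrite dE dvdpZr // pE rE mulrC mul_polyC map_polyZ dvdpZl ?intr_eq0.
Qed.
End Norm.

(** * The modulus of a complex number *)

Section Modulus.
Variable R : rcfType.
Implicit Types z w : R[i].
(** Valued in the real field [R], where logarithms are taken later. *)
Definition modulus z : R := ComplexField.Normc.normc z.
Local Notation nm := modulus.

Lemma modulusE z : nm z = Num.sqrt (complex.Re z ^+ 2 + complex.Im z ^+ 2).
Proof. by case: z. Qed.
Lemma modulusM : {morph nm : z w / z * w}.
Proof. exact: Normc.normcM. Qed.
Lemma modulus0 : nm 0 = 0. Proof. exact: Normc.normc0. Qed.
Lemma modulus1 : nm 1 = 1. Proof. exact: Normc.normc1. Qed.
Lemma modulus_ge0 z : 0 <= nm z.
Proof. by rewrite modulusE sqrtr_ge0. Qed.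
Lemma modulus_eq0 z : (nm z == 0) = (z == 0).
Proof.
by apply/eqP/eqP => [/Normc.eq0_normc|->] //; exact: modulus0.
Qed.
Lemma modulus_gt0 z : (0 < nm z) = (z != 0).
Proof. by rewrite lt_def modulus_ge0 andbT modulus_eq0. Qed.
Lemma modulusV z : nm z^-1 = (nm z)^-1. Proof. exact: Normc.normcV. Qed.
Lemma modulusX z n : nm (z ^+ n) = nm z ^+ n.
Proof. by elim: n => [|n IH]; rewrite ?modulus1 // !exprS modulusM IH. Qed.
Lemma modulus_prod I (r : seq I) (P : pred I) (F : I -> R[i]) :
  nm (\prod_(i <- r | P i) F i) = \prod_(i <- r | P i) nm (F i).
Proof. exact: (big_morph nm modulusM modulus1). Qed.
Lemma modulusD z w : nm (z + w) <= nm z + nm w.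
Proof. exact: le_normcD. Qed.
Lemma modulusN z : nm (- z) = nm z. Proof. exact: normcN. Qed.
Lemma modulus_sum I (r : seq I) (P : pred I) (F : I -> R[i]) :
  nm (\sum_(i <- r | P i) F i) <= \sum_(i <- r | P i) nm (F i).
Proof.
elim/big_rec2: _ => [|i x y _ xy]; first by rewrite modulus0.
by rewrite (le_trans (modulusD _ _)) ?lerD2l.
Qed.
Lemma modulusJ z : nm (conjc z) = nm z.
Proof. by case: z => a b; rewrite !modulusE /= sqrrN. Qed.
Lemma ler_Re_modulus z : `|complex.Re z| <= nm z.
Proof. by rewrite modulusE -sqrtr_sqr ler_wsqrtr ?lerDl ?sqr_ge0. Qed.
Lemma ler_Im_modulus z : `|complex.Im z| <= nm z.
Proof. by rewrite modulusE -sqrtr_sqr ler_wsqrtr ?lerDr ?sqr_ge0. Qed.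
Lemma modulus_real (x : R) : nm (x%:C)%C = `|x|.
Proof. by rewrite modulusE /= expr0n addr0 sqrtr_sqr. Qed.
Lemma modulus_intr (k : int) : nm k%:~R = `|k|%:~R.
Proof. by rewrite -(rmorph_int (real_complex R)) modulus_real intr_norm. Qed.
Lemma modulus_le_ReIm z : nm z <= `|complex.Re z| + `|complex.Im z|.
Proof.
rewrite modulusE -[leRHS]ger0_norm ?addr_ge0 // -(sqrtr_sqr (_ + _)) ler_wsqrtr // sqrrD.
by rewrite !real_normK ?num_real // lerD2r lerDl mulrn_wge0 ?mulr_ge0.
Qed.
End Modulus.

(** * Units from the pigeonhole principle *)

Section Minkowski.
Variable R : realType.
Local Notation C := R[i].
Local Notation nm := (@modulus R).
Local Notation "p ^F" := (map_poly (intr : int -> C) p) (at level 2, format "p ^F").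

Lemma horner_intr_conjc (p : {poly int}) (z : C) : p^F.[conjc z] = conjc p^F.[z].
Proof.
rewrite -[in RHS]horner_map -map_poly_comp; congr (_.[_]).
by apply: eq_map_poly => a /=; rewrite rmorph_int.
Qed.

Variables (d : nat) (lam : 'I_d -> C) (out : pred 'I_d).
Hypothesis out_conj : forall j, out j -> exists2 j', out j' & lam j' = conjc (lam j).
Hypothesis out_proper : exists j, ~~ out j.

(* The real forms [rho j], one per root, determine the values at all the roots of
   a conjugation-stable set: the lower root of a pair provides the imaginary
   part of the value at the upper one. *)
Let rho j (v : C) := if 0 <= complex.Im (lam j) then complex.Re v else complex.Im v.

Let rhoB j v w : rho j (v - w) = rho j v - rho j w.
Proof. by rewrite /rho raddfB raddfB; case: ifP. Qed.

Let rho_le j v : `|rho j v| <= nm v.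
Proof. by rewrite /rho; case: ifP; rewrite ?ler_Re_modulus ?ler_Im_modulus. Qed.

(** At a non-real root one part of the value is bounded by the form of that root and the other by
    the form of its conjugate; at a real root the imaginary part is zero. *)
Let modulus_rho (a : {poly int}) (e : R) :
  (forall j, out j -> `|rho j a^F.[lam j]| <= e) ->
  forall j, out j -> nm a^F.[lam j] <= e *+ 2.
Proof.
move=> ae j oj; have [j' oj' lj'] := out_conj oj.
have := ae j oj; have := ae _ oj'.
rewrite /rho lj' horner_intr_conjc.
have : complex.Im (lam j) = 0 -> complex.Im a^F.[lam j] = 0.
  move=> l0; have l0' : conjc (lam j) = lam j by case: (lam j) l0 => x y /= ->; rewrite oppr0.
  move: (horner_intr_conjc a (lam j)); rewrite l0'.
  by case: (a^F.[_]) => x y /(congr1 (@complex.Im R)) /= h; lra.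
move: (lam j) (a^F.[_]) => [p q] [x y] /=; rewrite oppr_ge0 => qy.
have := modulus_le_ReIm (x +i* y)%C; rewrite /= mulr2n.
case: (ltgtP 0 q) => q0 h; rewrite ?normrN => h1 h2; apply: le_trans h _; apply: lerD => //.
by rewrite (qy (esym q0)) normr0 (le_trans _ h1).
Qed.

(* With [e] roots in [out], compare the polynomials with coefficients in
   [0, m ^ e] with a partition of the range of their values at the roots in
   [out] in [m ^ d] intervals per real form: (m ^ e + 1) ^ d > (m ^ d) ^ e. *)
Lemma small_poly : exists2 K : R, 0 <= K & forall m : nat, (0 < m)%N ->
  exists a : {poly int}, [/\ a != 0, (size a <= d)%N,
    forall j, out j -> nm a^F.[lam j] <= K / m%:R &
    \prod_j nm a^F.[lam j] <= K].
Proof.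
have [k0 nk0] := out_proper.
pose e := #|[pred j | out j]|.
have ed : (e < d)%N.
  have := cardC [pred j | out j]; rewrite -/e card_ord => <-.
  by rewrite -[ltnLHS]addn0 ltn_add2l; apply/card_gt0P; exists k0.
pose T : R := \sum_j \sum_(i < d) nm (lam j) ^+ i.
(* The summand 1 makes the bound [H * S] on the values strict, which keeps [x] below [D]. *)
pose S := 1 + T.
have S0 : 1 <= S by rewrite lerDl; do 2 (apply: sumr_ge0 => ? _); rewrite exprn_ge0 ?modulus_ge0.
(* The intervals have width [2 * H * S / D], and [modulus_rho] doubles it. *)
pose K0 := 4 * S.
have K00 : 0 < K0 by rewrite /K0; lra.
(* [K0] serves the values at the roots in [out], and [K0 ^+ d] serves the product. *)
exists (K0 + K0 ^+ d) => [|m m0]; first by rewrite addr_ge0 ?exprn_ge0 ?ltW.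
pose H := (m ^ e)%N; pose D := (m ^ d)%N.
have H0 : (0 < H)%N by rewrite expn_gt0 m0.
have D0 : (0 < D)%N by rewrite expn_gt0 m0.
pose poly_of (c : {ffun 'I_d -> 'I_H.+1}) : {poly int} :=
  \poly_(i < d) oapp (fun i : 'I_d => (c i : nat)%:Z) 0 (insub i).
have coef_poly_of c (i : 'I_d) : (poly_of c)`_i = (c i : nat)%:Z.
  by rewrite coef_poly ltn_ord valK.
have size_poly_of c : (size (poly_of c) <= d)%N by exact: size_poly.
have poly_ofE c z : (poly_of c)^F.[z] = \sum_(i < d) (c i)%:R * z ^+ i.
  rewrite (@horner_coef_wide _ d); last by rewrite (leq_trans (size_poly _ _)).
  by apply: eq_bigr => i _; rewrite coef_map coef_poly_of /= -pmulrn.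
have Hpos : 0 < H%:R :> R by rewrite ltr0n.
have Dpos : 0 < D%:R :> R by rewrite ltr0n.
have val_le c j : nm (poly_of c)^F.[lam j] < H%:R * S.
  rewrite poly_ofE (le_lt_trans (modulus_sum _ _ _)) // /S mulrDr mulr1.
  rewrite -[ltLHS]add0r ltr_leD // [T](bigD1 j) //= mulrDr -[leLHS]addr0 lerD //; last first.
    by rewrite mulr_ge0 ?ler0n //; do 2 (apply: sumr_ge0 => ? _); rewrite exprn_ge0 ?modulus_ge0.
  rewrite mulr_sumr; apply: ler_sum => i _; rewrite modulusM modulusX.
  rewrite -[(c i)%:R]/((c i : nat)%:R) -(rmorph_nat (real_complex R)) modulus_real normr_nat.
  by rewrite ler_wpM2r ?exprn_ge0 ?modulus_ge0 // ler_nat -ltnS ltn_ord.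
pose x c j := (rho j (poly_of c)^F.[lam j] + H%:R * S) / (H%:R * S *+ 2) * D%:R.
have HS : 0 < H%:R * S by rewrite mulr_gt0 //; lra.
have x_itv c j : 0 <= x c j < D%:R.
  have := le_lt_trans (rho_le j _) (val_le c j); rewrite ltr_norml => /andP[h1 h2].
  rewrite /x mulr_ge0 ?ler0n ?divr_ge0 //=; try by lra.
  by rewrite gtr_pMl // ltr_pdivrMr; lra.
pose box c : {ffun {j | out j} -> 'I_D.-1.+1} :=
  [ffun j => inord (Num.truncn (x c (val j)))].
have : ~~ injectiveb box.
  apply/injectiveP => /leq_card; rewrite !card_ffun !card_ord card_sig prednK //.
  rewrite leqNgt => /negP; apply; rewrite -/e -expnM mulnC expnM -/H.
  by rewrite ltn_exp2r // (leq_ltn_trans _ ed).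
case/injectivePn => c [c' cc' bcc'].
pose a := poly_of c - poly_of c'.
exists a.
have a0 : a != 0.
  apply: contraNneq cc' => /eqP; rewrite subr_eq0 => /eqP pE.
  apply/eqP/ffunP => i; apply: val_inj; apply/eqP.
  by rewrite -eqz_nat -!coef_poly_of pE.
have sa : (size a <= d)%N.
  by rewrite (leq_trans (size_polyD _ _)) // geq_max size_polyN !size_poly_of.
have aE j : a^F.[lam j] = (poly_of c)^F.[lam j] - (poly_of c')^F.[lam j].
  by rewrite rmorphB hornerD hornerN.
have a_out j : out j -> nm a^F.[lam j] <= K0 * (H%:R / D%:R).
  rewrite (_ : K0 * _ = (H%:R * S *+ 2 / D%:R) *+ 2); last by rewrite /K0; field; lra.
  apply: modulus_rho => {j} j oj; rewrite aE rhoB.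
  have /ffunP/(_ (exist _ j oj)) := bcc'; rewrite !ffunE /= => /(congr1 val) /=.
  have tlt c0 : (Num.truncn (x c0 j) < D.-1.+1)%N.
    have /andP[x0 xD] := x_itv c0 j; have /andP[y1 _] := truncn_itv x0.
    by rewrite prednK // -(ltr_nat R) (le_lt_trans y1).
  rewrite !inordK // => tE.
  have /andP[x0 _] := x_itv c j; have /andP[x0' _] := x_itv c' j.
  have /andP[y1 y2] := truncn_itv x0; have /andP[y1' y2'] := truncn_itv x0'.
  move: y1 y2; rewrite tE => y1 y2.
  have : `|x c j - x c' j| <= 1.
    by rewrite -natr1 in y2 y2' *; rewrite ler_norml; lra.
  have -> : x c j - x c' j = (rho j (poly_of c)^F.[lam j] - rho j (poly_of c')^F.[lam j])
     * (H%:R * S *+ 2 / D%:R)^-1.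
    by rewrite /x; field; lra.
  have P0 : 0 < H%:R * S *+ 2 / D%:R by rewrite divr_gt0 // pmulrn_lgt0.
  by rewrite normrM normfV [`|_ / D%:R|]gtr0_norm // ler_pdivrMr // mul1r.
have a_in j : nm a^F.[lam j] <= K0 * H%:R.
  rewrite aE (le_trans (modulusD _ _)) // modulusN.
  have h1 := val_le c j; have h2 := val_le c' j; rewrite /K0.
  suff : H%:R * S *+ 2 <= 4 * S * H%:R by lra.
  by lra.
split=> // [j oj|].
  apply: le_trans (a_out j oj) _.
  have HDm : H%:R / D%:R <= m%:R^-1 :> R.
    rewrite ler_pdivrMr // ler_pdivlMl ?ltr0n // -natrM ler_nat.
    by rewrite /D /H -expnS leq_pexp2l.
  have mp : 0 < m%:R^-1 :> R by rewrite invr_gt0 ltr0n.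
  rewrite (le_trans (ler_wpM2l (ltW K00) HDm)) // ler_pM2r // lerDl.
  by rewrite exprn_ge0 ?ltW.
(* The powers of [m] cancel: [H ^ d] and [D ^ e] both equal [m ^ (d * e)]. *)
apply: (@le_trans _ _ (\prod_j (K0 * H%:R * (if out j then D%:R^-1 else 1)))).
  apply: ler_prod => j _; rewrite modulus_ge0 /=; case: ifP => oj.
    by rewrite -mulrA a_out.
  by rewrite mulr1.
rewrite big_split /= prodr_const card_ord -big_mkcond /= prodr_const -/e exprMn.
rewrite -mulrA exprVn -!natrX -/e.
rewrite /H /D -!expnM (mulnC d) divff ?mulr1 ?lerDr ?ltW //.
by rewrite pnatr_eq0 -lt0n expn_gt0 m0.
Qed.
End Minkowski.

Section SmallUnit.
Variable R : realType.
Local Notation C := R[i].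
Local Notation nm := (@modulus R).
Local Notation "p ^F" := (map_poly (intr : int -> C) p) (at level 2, format "p ^F").

(* Iterating [small_poly] gives polynomials of bounded norm and decreasing values
   at the roots in [out].  Two of them are congruent modulo a common multiple
   [B] of their norms times the norm [Q] of [q]; their quotient is then the
   value of a polynomial of the form [1 + q * g], and so is its inverse. *)
Lemma unit_small_outside (p q : {poly int}) (d : nat) (lam : 'I_d -> C) (out : pred 'I_d) :
  p \is monic -> irreducible_elt p -> p^F = \prod_j ('X - (lam j)%:P) ->
  (forall j, q^F.[lam j] != 0) ->
  (forall j, out j -> exists2 j', out j' & lam j' = conjc (lam j)) ->
  (exists j, ~~ out j) ->
  exists g g' : {poly int}, forall j,
    (1 + q * g)^F.[lam j] * (1 + q * g')^F.[lam j] = 1 /\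
    (out j -> nm (1 + q * g)^F.[lam j] < 1).
Proof.
move=> pm p_irr plam q0 out_conj out_proper.
have pseq : p^F = \prod_(z <- codom lam) ('X - z%:P) by rewrite big_image.
have sp : size p = d.+1.
  have := congr1 (fun f : {poly C} => size f) pseq.
  rewrite size_map_inj_poly //; last exact: intr_inj.
  by rewrite (size_prod_XsubC _ id) size_codom card_ord.
have d0 : (0 < d)%N by case: out_proper => j _; apply: leq_trans (ltn_ord j).
have inlam j : lam j \in codom lam by exact: codom_f.
have norm_lam g : exists (N : int) (h : {poly int}), N%:~R = \prod_j g^F.[lam j] /\
    forall j, g^F.[lam j] * h^F.[lam j] = N%:~R.
  have [|N [h [Ng gh]]] := norm_poly g pm _ pseq; first by rewrite sp ltnS.
  by exists N, h; split=> [|j]; [rewrite Ng big_image | apply: gh].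
have plam0 j : root p^F (lam j) by rewrite pseq root_prod_XsubC.
have [K K0 small] := small_poly out_conj out_proper.
pose good (a : {poly int}) := [/\ a != 0, (size a <= d)%N & \prod_j nm a^F.[lam j] <= K].
(* Otherwise [p], of degree [d], would divide a nonzero polynomial of smaller degree. *)
have good_neq0 a j : good a -> a^F.[lam j] != 0.
  case=> a0 sa _; apply/negP => /(irreducible_root_dvdp pm p_irr (plam0 j)) /dvdp_leq.
  by rewrite -size_poly_eq0 !size_rat_int_poly size_poly_eq0 sp ltnNge sa => /(_ a0).
(* The norm of a good polynomial is a nonzero integer of absolute value at most [K], hence a divisor
   of this factorial. *)
pose B := (Num.truncn K)`!.
have good_inv a : good a -> exists h : {poly int}, forall j, a^F.[lam j] * h^F.[lam j] = B%:R.
  move=> ga; have [N [h [Na ah]]] := norm_lam a.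
  have N0 : N != 0.
    by rewrite -(intr_eq0 C) Na; apply/prodf_neq0 => j _; apply: good_neq0.
  have NB : (absz N %| B)%N.
    apply: dvdn_fact; rewrite absz_gt0 N0 /= truncn_ge_nat //.
    case: ga => _ _; rewrite -modulus_prod -Na modulus_intr.
    by rewrite -abszE -pmulrn.
  have /dvdzP[t Bt] : (N %| B%:Z)%Z by rewrite dvdzE.
  exists (t *: h) => j; rewrite map_polyZ hornerZ mulrCA ah -intrM -Bt.
  by rewrite -pmulrn.
have [Q [q' [Qq qq']]] := norm_lam q.
have Q0 : Q != 0 by rewrite -(intr_eq0 C) Qq; apply/prodf_neq0 => j _; apply: q0.
have next a : exists a', good a -> good a' /\ forall j, out j -> nm a'^F.[lam j] < nm a^F.[lam j].
  have [ga|] := pselect (good a); last by exists 0.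
  (* Large enough that [K / m] is below the modulus of [a] at every root. *)
  pose m := (\max_j Num.truncn (K / nm a^F.[lam j])).+1.
  have [|a' [a'0 sa' a'out a'K]] := small m; first by [].
  exists a' => _; split=> // j oj; apply: le_lt_trans (a'out j oj) _.
  have aj : 0 < nm a^F.[lam j] by rewrite modulus_gt0 good_neq0.
  rewrite ltr_pdivrMr ?ltr0n // mulrC -ltr_pdivrMr //.
  apply: lt_le_trans (truncnS_gt _) _; rewrite ler_nat ltnS.
  exact: (leq_bigmax j).
have [nxt nxtP] := choice next.
have [|a0 [a00 sa0 _ a0K]] := small 1%N; first by [].
pose b t := iter t nxt a0.
have good_b t : good (b t) by elim: t => [|t /nxtP[]].
have b_lt t t' j : out j -> (t < t')%N -> nm (b t')^F.[lam j] < nm (b t)^F.[lam j].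
  move=> oj; elim: t' => // t' IH; rewrite ltnS leq_eqVlt => /predU1P[->|/IH].
    by have [_ /(_ j oj)] := nxtP _ (good_b t').
  by apply: lt_trans; have [_ /(_ j oj)] := nxtP _ (good_b t').
pose md := B%:Z * Q.
have md0 : md != 0 by rewrite mulf_neq0 // -lt0n fact_gt0.
(* The residues of the coefficients modulo [md] take finitely many values. *)
pose cls t := [ffun i : 'I_d => inord (absz ((b t)`_i %% md)%Z) : 'I_(absz md).-1.+1].
have [t [t' [tt' _ ctt']]] := pigeonhole_seq (fun t => mem_enum predT (cls t)).
pose c : {poly int} := \poly_(i < d) (((b t')`_i - (b t)`_i) %/ md)%Z.
have bc : b t' - b t = md *: c.
  apply/polyP => i; rewrite coefZ coefB coef_poly; case: ltnP => id; last first.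
    have [_ s1 _] := good_b t; have [_ s2 _] := good_b t'.
    by rewrite !nth_default ?mulr0 ?subr0 // (leq_trans _ id).
  have : (md %| (b t')`_i - (b t)`_i)%Z.
    have /ffunP/(_ (Ordinal id)) := ctt'; rewrite !ffunE /= => /(congr1 val) /=.
    have h s : (absz ((b s)`_i %% md)%Z < (absz md).-1.+1)%N.
      by rewrite prednK ?absz_gt0 // -ltz_nat gez0_abs ?modz_ge0 // abszE ltz_mod.
    rewrite !inordK // => /(congr1 Posz); rewrite !gez0_abs ?modz_ge0 // => /esym/eqP.
    by rewrite eqz_mod_dvd.
  by move=> mdv; rewrite mulrC divzK.
have [h bh] := good_inv _ (good_b t); have [h' bh'] := good_inv _ (good_b t').
have cE j : (b t')^F.[lam j] - (b t)^F.[lam j] = B%:R * Q%:~R * c^F.[lam j].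
  by rewrite -hornerN -hornerD -rmorphB /= bc map_polyZ hornerZ /= /md intrM -pmulrn.
(* At each root, [b t' - b t] is [B * Q * c] with [B = b t * h] and [Q = q * q']; dividing by [b t]
   gives [1 + q * (q' * c * h)]. The inverse quotient uses [B = b t' * h']. *)
exists (q' * c * h), (- (q' * c * h')) => j.
have a1 : (b t)^F.[lam j] != 0 by apply: good_neq0.
have a2 : (b t')^F.[lam j] != 0 by apply: good_neq0.
have ev f g : (1 + q * (q' * f * g))^F.[lam j]
    = 1 + q^F.[lam j] * (q'^F.[lam j] * f^F.[lam j] * g^F.[lam j]).
  by rewrite !(rmorphD, rmorphM, rmorph1) /= !hornerE.
have evN f : (- f)^F.[lam j] = - f^F.[lam j] by rewrite rmorphN hornerN.
have e1 : (1 + q * (q' * c * h))^F.[lam j] = (b t')^F.[lam j] / (b t)^F.[lam j].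
  apply: (mulIf a1); rewrite divfK // ev.
  have := cE j; rewrite -(bh j) -(qq' j) => /eqP; rewrite subr_eq => /eqP ->.
  by ring.
have e2 : (1 + q * (- (q' * c * h')))^F.[lam j] = (b t)^F.[lam j] / (b t')^F.[lam j].
  apply: (mulIf a2); rewrite divfK // -mulrN ev evN.
  have := cE j; rewrite -(bh' j) -(qq' j) => /eqP; rewrite subr_eq addrC -subr_eq => /eqP <-.
  by ring.
rewrite e1 e2; split=> [|oj]; first by rewrite mulrA divfK // divff.
by rewrite modulusM modulusV ltr_pdivrMr ?mul1r ?modulus_gt0 // b_lt.
Qed.
End SmallUnit.

(** * Diagonalization of a simple matrix *)

Lemma common_denominator m p (X : 'M[rat]_(m, p)) :
  exists2 D : int, D != 0 & exists Y : 'M[int]_(m, p), D%:~R *: X = map_mx intr Y.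
Proof.
exists (\prod_i \prod_j denq (X i j)).
  by apply/prodf_neq0 => i _; apply/prodf_neq0 => j _; apply: denq_neq0.
exists (\matrix_(i, j) (numq (X i j) * (\prod_(k | k != j) denq (X i k)
   * \prod_(k | k != i) \prod_l denq (X k l)))).
apply/matrixP => i j; rewrite !mxE (bigD1 i) //= (bigD1 j) //= !intrM.
by rewrite [X in _ = X * _]numqE; ring.
Qed.

Lemma char_poly_conj (F : fieldType) n (V A B : 'M[F]_n) :
  V \in unitmx -> V *m A = B *m V -> char_poly A = char_poly B.
Proof.
move=> Vu VA; pose Vp := map_mx polyC V.
have Vp0 : \det Vp != 0.
  by rewrite det_map_mx polyC_eq0; move: Vu; rewrite unitmxE unitfE.
apply: (mulfI Vp0); rewrite /char_poly -det_mulmx mulrC -det_mulmx; congr (\det _).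
by rewrite /char_poly_mx mulmxBr mulmxBl mul_mx_scalar mul_scalar_mx -!map_mxM VA.
Qed.

Section Spectral.
Variables (R : realType) (n : nat) (M : 'M[int]_n.+1).
Local Notation C := R[i].
Local Notation nm := (@modulus R).
Local Notation "p ^F" := (map_poly (intr : int -> C) p) (at level 2, format "p ^F").
Local Notation mC := (map_mx (intr : int -> C)).

(** The minimal polynomial divides the characteristic one, a product of distinct linear factors.
    Similarity preserves the latter, so the diagonal entries are distinct too. *)
Lemma simple_diagonalization : simple_mx R M ->
  exists (V : 'M[C]_n.+1) (lam : 'rV[C]_n.+1),
    [/\ V \in unitmx, injective (lam 0), V *m mC M = diag_mx lam *m V &
        (char_poly M)^F = \prod_j ('X - (lam 0 j)%:P)].
Proof.
move=> simpleM.
have [rs] := closed_field_poly_normal (char_poly (mC M)).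
rewrite (monicP (char_poly_monic _)) scale1r => Ers.
have urs : uniq rs.
  apply: count_mem_uniq => z; case zrs: (z \in rs); last first.
    by apply/count_memPn; rewrite zrs.
  rewrite -mu_prod_XsubC -Ers; apply: simpleM.
  by rewrite eigenvalue_root_char Ers root_prod_XsubC.
have [V Vu /diagonalizable_forPex[lam /(simmxPp (stablemx_unit _ Vu)) VM]] :
    diagonalizable (mC M).
  by apply/diagonalizableP; exists rs; rewrite // -Ers mxminpoly_dvd_char.
have EM : char_poly (mC M) = \prod_j ('X - (lam 0 j)%:P).
  rewrite (char_poly_conj Vu VM) char_poly_trig ?diag_mx_is_trig //.
  by apply: eq_bigr => j _; rewrite mxE eqxx.
exists V, lam; split=> //; last by rewrite map_char_poly.
suff sperm : perm_eq (codom (lam 0)) rs.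
  by apply/injectiveP; rewrite -[injectiveb _]/(uniq (codom (lam 0))) (perm_uniq sperm).
by apply: prod_XsubC_eq; rewrite -Ers EM big_image.
Qed.

(** Commuting with a diagonal matrix kills the entry at [i, j] up to the factor [lam i - lam j],
    nonzero off the diagonal. *)
Lemma diagonal_of_commuting (V G : 'M[C]_n.+1) (lam : 'rV_n.+1) (A : 'M[C]_n.+1) :
  V \in unitmx -> injective (lam 0) -> V *m A = diag_mx lam *m V ->
  A *m G = G *m A ->
  V *m G = diag_mx (\row_j (V *m G *m invmx V) j j) *m V.
Proof.
move=> Vu lam_inj VA AG; set G' := V *m G *m invmx V.
suff {1}-> : diag_mx (\row_j G' j j) = G' by rewrite /G' mulmxKV.
have comm : diag_mx lam *m G' = G' *m diag_mx lam.
  have -> : diag_mx lam = V *m A *m invmx V by rewrite VA mulmxK.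
  rewrite /G' !mulmxA (mulmxKV Vu (V *m A)) (mulmxKV Vu (V *m G)) -!mulmxA; congr (_ *m _).
  by rewrite !mulmxA AG.
apply/matrixP => i j; rewrite [LHS]mxE mxE; case: eqP => [-> //|ij].
rewrite mulr0n; apply/esym/eqP; move/matrixP/(_ i j)/eqP: comm.
rewrite mul_diag_mx mul_mx_diag !mxE mulrC -subr_eq0 -mulrBr mulf_eq0 => /orP[//|].
by rewrite subr_eq0 => /eqP/lam_inj.
Qed.

(** This is the interface to the diagonalization: [chi G j] is the eigenvalue of [G] on the [j]-th
    common eigenvector, [D] clears denominators and [K] recovers bounds on the entries. *)
Lemma spectral_character : simple_mx R M ->
  exists (lam : 'I_n.+1 -> C) (chi : 'M[int]_n.+1 -> 'I_n.+1 -> C) (D : int) (K : R),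
  [/\ injective lam, (char_poly M)^F = \prod_j ('X - (lam j)%:P), D != 0 & 0 <= K] /\
  [/\ forall G H j, M *m G = G *m M -> M *m H = H *m M ->
        chi (G *m H) j = chi G j * chi H j,
      forall f j, chi (horner_mx M f) j = f^F.[lam j],
      forall G, M *m G = G *m M -> exists g, forall j, D%:~R * chi G j = g^F.[lam j],
      forall G H, M *m G = G *m M -> M *m H = H *m M -> chi G =1 chi H -> G = H &
      forall G i j, M *m G = G *m M -> `|G i j|%:~R <= K * \sum_k nm (chi G k)].
Proof.
move=> /simple_diagonalization[V [lam [Vu lam_inj VM Mlam]]].
pose chi (G : 'M[int]_n.+1) := \row_j (V *m mC G *m invmx V) j j.
have chiP G : M *m G = G *m M -> V *m mC G = diag_mx (chi G) *m V.
  by move=> MG; apply: diagonal_of_commuting VM _ => //; rewrite -!map_mxM MG.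
have GE G : M *m G = G *m M -> mC G = invmx V *m diag_mx (chi G) *m V.
  by move=> MG; rewrite -mulmxA -chiP // mulKmx.
pose MQ := map_mx (intr : int -> rat) M.
have mCE k p (X : 'M[int]_(k, p)) : map_mx (ratr : rat -> C) (map_mx intr X) = mC X.
  by apply/matrixP => i j; rewrite !mxE ratr_int.
(* The pseudo-inverse solves for the coefficients of a matrix in the powers of [M]; its denominators
   do not depend on that matrix. *)
have [D D0 [Y DY]] := common_denominator (pinvmx (powers_mx MQ (degree_mxminpoly MQ))).
(* Interpolation at the distinct [lam j] produces a complex polynomial with values [chi G], hence
   one that gives [G] at [M]. *)
have vanderu : Vandermonde n.+1 lam \in unitmx.
  rewrite unitmxE unitfE det_Vandermonde; apply/prodf_neq0 => i _; apply/prodf_neq0 => j ij.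
  by rewrite subr_eq0 (inj_eq lam_inj) eq_sym neq_ltn; apply/orP; left.
have poly_G G : M *m G = G *m M -> exists f, mC G = horner_mx (mC M) f.
  move=> MG; exists (rVpoly (chi G *m invmx (Vandermonde n.+1 lam))).
  rewrite GE // -[mC M](mulKmx Vu) VM mulmxA horner_mx_uconjC // horner_mx_diag.
  congr (_ *m diag_mx _ *m _); rewrite -[LHS](mulmxKV vanderu); apply/rowP => j.
  rewrite mxE [RHS]mxE; set c := chi G *m _.
  rewrite (@horner_coef_wide _ n.+1) ?size_poly //; apply: eq_bigr => i _.
  by rewrite coef_rVpoly_ord; congr (_ * _); rewrite mxE.
have polyQ G : M *m G = G *m M -> exists g, D *: G = horner_mx M g.
  move=> MG; have [f Gf] := poly_G G MG.
  (* Membership in the span of the powers of [M] is a rational linear condition, so it can be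
     checked over the complex numbers. *)
  have : (map_mx intr G \in powers_mx MQ (degree_mxminpoly MQ))%MS.
    rewrite -(map_submx (ratr : {rmorphism rat -> C})) map_mxvec map_powers_mx !mCE.
    by rewrite -(degree_mxminpoly_map (ratr : {rmorphism rat -> C})) mCE Gf horner_mx_mem.
  move/mx_inv_hornerK; rewrite /mx_inv_horner; set A := powers_mx _ _ in Y DY *.
  move=> GQ; exists (rVpoly (mxvec G *m Y)).
  suff : map_mx (intr : int -> rat) (D *: G) = map_mx intr (horner_mx M (rVpoly (mxvec G *m Y))).
    move=> /matrixP E; apply/matrixP => i j; have := E i j; rewrite !mxE; exact: intr_inj.
  rewrite map_mxZ map_horner_mx map_rVpoly map_mxM -DY -scalemxAr linearZ /= linearZ /=.
  by rewrite map_mxvec GQ.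
have chiH f : chi (horner_mx M f) = \row_j f^F.[lam 0 j].
  apply/rowP => j; rewrite mxE map_horner_mx -[mC M](mulKmx Vu) VM mulmxA.
  rewrite horner_mx_uconjC // horner_mx_diag !mulmxA mulmxV // mul1mx mulmxK //.
  by rewrite !mxE eqxx.
pose K := (\sum_i \sum_k nm (invmx V i k)) * \sum_k \sum_j nm (V k j).
have sum_nm_ge0 (X : 'M[C]_n.+1) : 0 <= \sum_i \sum_k nm (X i k).
  by do 2 (apply: sumr_ge0 => ? _); exact: modulus_ge0.
have sum_nm_ge (X : 'M[C]_n.+1) i k : nm (X i k) <= \sum_i \sum_k nm (X i k).
  rewrite (bigD1 i) //= (bigD1 k) //= -addrA lerDl addr_ge0 //.
    by apply: sumr_ge0 => ? _; exact: modulus_ge0.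
  by do 2 (apply: sumr_ge0 => ? _); exact: modulus_ge0.
exists (lam 0), (fun G => chi G 0), D, K; split; split=> //.
- by rewrite mulr_ge0.
- move=> G H j MG MH; rewrite mxE map_mxM mulmxA chiP // -[_ *m V *m _]mulmxA chiP //.
  rewrite mulmxA mulmx_diag mulmxK // mxE eqxx mulr1n mxE //.
- by move=> f j; rewrite chiH mxE.
- move=> G MG; have [g Dg] := polyQ G MG; exists g => j.
  have := congr1 (fun c : 'rV[C]_n.+1 => c 0 j) (chiH g); rewrite /= -Dg [RHS]mxE => <-.
  by rewrite [RHS]mxE map_mxZ -scalemxAr -scalemxAl [RHS]mxE [chi G 0 j]mxE.
- move=> G H MG MH /rowP E; have := GE G MG; rewrite E -GE // => /matrixP GH.
  by apply/matrixP => i j; have := GH i j; rewrite !mxE => /intr_inj.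
- move=> G i j MG; rewrite -(modulus_intr R).
  have -> : (G i j)%:~R = mC G i j by rewrite mxE.
  rewrite GE // mxE (le_trans (modulus_sum _ _ _)) // mulr_sumr; apply: ler_sum => k _.
  rewrite mul_mx_diag mxE !modulusM mulrAC ler_wpM2r ?modulus_ge0 //.
  by rewrite ler_pM ?modulus_ge0 ?sum_nm_ge.
Qed.
End Spectral.

(** * Dominant matrices, characters and root blocks *)

(* In a vanishing combination of the columns, look at the row where the
   coefficient is maximal relatively to [w]. *)
Lemma zmatrix_unit (F : realFieldType) r (A : 'M[F]_r) (w : 'I_r -> F) :
  (forall i, 0 < w i) -> (forall i j, i != j -> A i j <= 0) ->
  (forall i, 0 < \sum_j A i j * w j) -> A \in unitmx.
Proof.
move=> w0 A_off A_dom; rewrite unitmxE unitfE -det_tr.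
apply/negP => /det0P[v /rV0Pn[j0 vj0] vA].
pose j := [arg max_(j > j0) (`|v 0 j| / w j)]%O; pose t := `|v 0 j| / w j.
have t_max k : `|v 0 k| <= t * w k.
  rewrite -ler_pdivrMr // /t /j; case: arg_maxP => // i _; exact.
have t0 : 0 < t.
  by rewrite -(pmulr_lgt0 _ (w0 j0)) (lt_le_trans _ (t_max j0)) // normr_gt0.
have vj : `|v 0 j| = t * w j by rewrite /t divfK // gt_eqF.
have : \sum_k A j k * (Num.sg (v 0 j) * v 0 k) = 0.
  under eq_bigr => k _ do rewrite mulrCA; rewrite -mulr_sumr.
  have := congr1 (fun u : 'rV_r => u 0 j) vA; rewrite !mxE.
  under eq_bigr => k _ do rewrite mxE mulrC.
  by move=> ->; rewrite mulr0.
apply/eqP; rewrite gt_eqF // (lt_le_trans (mulr_gt0 t0 (A_dom j))) // mulr_sumr.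
apply: ler_sum => k _; have [->|kj] := eqVneq k j.
  by rewrite -normrEsg vj mulrCA.
rewrite mulrCA ler_wnM2l ?A_off // 1?eq_sym // (le_trans (ler_norm _)) // normrM.
by rewrite (le_trans _ (t_max k)) // ler_piMl // normr_sg lern1 leq_b1.
Qed.

(** A finite group of units of a field is cyclic. So modulo the kernel of the first character one
    generator suffices, and the other characters separate the elements of that kernel. *)
Lemma generated_by_characters (gT : finGroupType) (F : fieldType) l
    (f : 'I_l -> gT -> F) (G : {group gT}) :
  abelian G -> (forall i, f i 1%g = 1) ->
  (forall i, {in G &, {morph f i : x y / (x * y)%g >-> x * y}}) ->
  (forall x, x \in G -> (forall i, f i x = 1) -> x = 1%g) ->
  exists A : {set gT}, (#|A| <= l)%N /\ <<A>>%g = G.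
Proof.
elim: l f G => [|l IH] f G abG f1 fM f_inj.
  exists finset.set0; split; first by rewrite cards0.
  rewrite gen0; apply/esym/trivgP/fintype.subsetP => x xG.
  by rewrite (f_inj x xG) ?group1 // => -[].
pose k := f ord0.
have K_group : group_set [set x in G | k x == 1].
  apply/group_setP; split=> [|x y]; first by rewrite inE group1 /k f1 eqxx.
  rewrite !inE => /andP[xG /eqP kx] /andP[yG /eqP ky].
  by rewrite groupM // /k fM // [f _ x]kx [f _ y]ky mulr1 eqxx.
pose Kg := Group K_group.
have KG : Kg \subset G by apply/fintype.subsetP => x; rewrite inE => /andP[].
have nKG : (Kg <| G)%g by rewrite -sub_abelian_normal.
have [A [Al AK]] : exists A : {set gT}, (#|A| <= l)%N /\ <<A>>%g = Kg.
  apply: (IH (fun i => f (lift ord0 i))) => [|i|i x y xK yK|x xK h].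
  - exact: abelianS abG.
  - exact: f1.
  - by apply: fM; apply: (fintype.subsetP KG).
  apply: f_inj => [|i]; first exact: (fintype.subsetP KG).
  case: (unliftP ord0 i) => [j ->|->]; first exact: h.
  by move: xK; rewrite inE => /andP[_ /eqP].
have kV x : x \in G -> k x^-1%g * k x = 1 by move=> xG; rewrite -fM ?groupV // mulVg /k f1.
have kX x m : x \in G -> k (x ^+ m)%g = k x ^+ m.
  by move=> xG; elim: m => [|m IHm]; rewrite ?expg0 /k ?f1 // expgS exprS fM ?groupX // -/k IHm.
have k_coset x y : x \in G -> y \in G -> (x * y^-1)%g \in Kg -> k x = k y.
  move=> xG yG; rewrite inE => /andP[_ /eqP]; rewrite /k fM ?groupV // => h.
  by rewrite -[LHS]mulr1 -(kV y yG) mulrA h mul1r.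
pose kq (c : coset_of Kg) := k (repr c).
have kqE x : x \in G -> kq (coset Kg x) = k x.
  move=> xG; have xN : x \in 'N(Kg)%g by apply: fintype.subsetP (normal_norm nKG) _ xG.
  have : repr (coset Kg x) \in (Kg :* x)%g by rewrite -(val_coset xN) mem_repr_coset.
  case/rcosetP => y yK rE; rewrite /kq rE /k fM ?(fintype.subsetP KG y yK) //.
  by move: yK; rewrite inE => /andP[_ /eqP ky]; rewrite [f _ y]ky mul1r.
have cycGK : cyclic (G / Kg)%g.
  apply: (@field_mul_group_cyclic _ _ F kq).
    move=> _ _ /morphimP[x xN xG ->] /morphimP[y yN yG ->].
    by rewrite -morphM // !kqE ?groupM // /k fM.
  move=> _ /morphimP[x xN xG ->]; rewrite kqE //; split=> [kx|/coset_idr xK].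
    by apply: coset_id; rewrite inE xG kx eqxx.
  by have := xK xN; rewrite inE => /andP[_ /eqP].
have [c Gc] := cyclicP cycGK.
have : c \in (G / Kg)%g by rewrite Gc cycle_id.
case/morphimP => x xN xG cx.
exists (x |: A); split; first by rewrite (leq_trans (leq_card_setU _ _)) // cards1 add1n ltnS.
apply/eqP; rewrite finset.eqEsubset gen_subG finset.subUset finset.sub1set xG /=; apply/andP; split.
  by rewrite (fintype.subset_trans (subset_gen A)) // AK.
apply/fintype.subsetP => y yG.
have : coset Kg y \in (G / Kg)%g by rewrite mem_quotient.
rewrite Gc cx => /cycleP[m ym].
have kyx : k y = k x ^+ m.
  rewrite -(kqE y yG) ym -(kX x m xG) -kqE ?groupX // morphX //.
have xX : x \in <<x |: A>>%g by rewrite mem_gen // finset.setU11.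
rewrite -(mulgKV (x ^+ m)%g y) groupM ?groupX //.
have /fintype.subsetP sub : (<<A>> \subset <<x |: A>>)%g by rewrite genS // finset.subsetUr.
apply: sub; rewrite AK inE groupM ?groupV ?groupX //=.
rewrite /k fM ?groupV ?groupX // [f _ y]kyx -kX // mulrC; apply/eqP.
by apply: kV; rewrite groupX.
Qed.

Lemma bounded_multiples_ge0 (F : archiRealFieldType) (a c : F) :
  (forall k : nat, c <= a *+ k) -> 0 <= a.
Proof.
move=> ac; rewrite leNgt; apply/negP => a0.
have := truncnS_gt (c / a); rewrite ltr_ndivrMr // mulr_natl.
by rewrite ltNge ac.
Qed.

Section Blocks.
Variables (F : closedFieldType) (n l : nat) (lam : 'I_n -> F) (P : 'I_l -> {poly F}).
Hypotheses (lam_inj : injective lam) (P_monic : forall i, P i \is monic).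
Hypothesis P_prod : \prod_i P i = \prod_j ('X - (lam j)%:P).

(** Since the [lam j] are distinct, the root lists of the factors have no repetition and are
    pairwise disjoint, so each index belongs to exactly one. *)
Lemma root_blocks : exists blk : 'I_n -> 'I_l,
  forall i, P i = \prod_(j | blk j == i) ('X - (lam j)%:P).
Proof.
have split (p : {poly F}) : p \is monic -> exists rs : seq F, p = \prod_(z <- rs) ('X - z%:P).
  by move=> pm; have [rs] := closed_field_poly_normal p; rewrite (monicP pm) scale1r; exists rs.
have [rs rsP] := choice (fun i => split _ (P_monic i)).
have codomE : \prod_j ('X - (lam j)%:P) = \prod_(z <- codom lam) ('X - z%:P).
  by rewrite big_image.
have ulam : uniq (codom lam) by move/injectiveP: lam_inj.
have rs_uniq i : uniq (rs i).
  have [|q qE] := split (\prod_(i' | i' != i) P i'); first exact: monic_prod.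
  have : perm_eq (rs i ++ q) (codom lam).
    by apply: prod_XsubC_eq; rewrite big_cat /= -rsP -qE big_image -P_prod [RHS](bigD1 i).
  by move/perm_uniq; rewrite ulam cat_uniq => /andP[].
have rs_disj i i' z : z \in rs i -> z \in rs i' -> i = i'.
  move=> zi zi'; apply/eqP/negPn/negP => ii'.
  have [|q qE] := split (\prod_(i1 | (i1 != i') && (i1 != i)) P i1); first exact: monic_prod.
  have : perm_eq (rs i' ++ (rs i ++ q)) (codom lam).
    apply: prod_XsubC_eq; rewrite !big_cat /= -!rsP -qE big_image -P_prod [RHS](bigD1 i') //=.
    by rewrite [in RHS](bigD1 i).
  move/perm_uniq; rewrite ulam cat_uniq => /and3P[_ /hasPn/(_ z)].
  by rewrite mem_cat zi zi' => /(_ isT).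
have ex_blk j : exists i, lam j \in rs i.
  have : root (\prod_i P i) (lam j).
    by rewrite P_prod codomE root_prod_XsubC codom_f.
  rewrite rootE horner_prod => /prodf_eq0[i _]; rewrite -rootE rsP root_prod_XsubC; by exists i.
have [blk blkP] := choice ex_blk.
exists blk => i; rewrite rsP.
have : perm_eq (rs i) [seq lam j | j in [pred j | blk j == i]].
  apply: uniq_perm => //.
    by rewrite map_inj_uniq ?enum_uniq.
  move=> z; apply/idP/fintype.imageP => [zi|[j /eqP <- ->] //].
  have : root (\prod_i P i) z.
    by rewrite (bigD1 i) //= rootM rsP root_prod_XsubC zi.
  rewrite P_prod codomE root_prod_XsubC => /codomP[j zj].
  exists j; rewrite ?inE //; apply/eqP; apply: (rs_disj _ _ (lam j)) (blkP j) _; by rewrite -zj.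
by move=> rs_perm; rewrite (perm_big _ rs_perm) big_image.
Qed.
End Blocks.

(** * Counting real and conjugate roots *)

Section Counting.
Local Open Scope classical_set_scope.
Local Open Scope card_scope.

(** This turns the set-theoretic root counts into cardinals of finite sets of indices. *)
Lemma card_param (m : nat) (A : pred 'I_m.+1) (U : Type) (S : set U) (f : 'I_m.+1 -> U) k :
  {in A &, injective f} -> (forall x, S x <-> exists2 j, A j & x = f j) ->
  S #= `I_k -> #|A| = k.
Proof.
move=> f_inj SP Sk; apply/eqP/negPn/negP => /eqP nk; apply: nk.
have nthA i : (i < #|A|)%N -> nth ord0 (enum A) i \in A.
  by move=> iA; rewrite -mem_enum mem_nth // -cardE.
pose g (i : nat) := f (nth ord0 (enum A) i).
have gS : g @` `I_#|A| = S.
  apply/seteqP; split=> [x [i iA <-]|x /SP[j Aj ->]].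
    by apply/SP; exists (nth ord0 (enum A) i) => //; exact: nthA.
  exists (index j (enum A)); first by rewrite /= cardE index_mem mem_enum.
  by rewrite /g nth_index // mem_enum.
have g_inj : {in `I_#|A| &, injective g}.
  move=> i i'; rewrite !inE => iA iA' /f_inj E.
  apply/eqP; rewrite -(nth_uniq ord0 _ _ (enum_uniq A)) -?cardE //.
  by apply/eqP/E; apply: nthA.
by apply/card_eq_II; apply: card_eq_trans Sk; rewrite -gS card_eq_sym; apply: inj_card_eq.
Qed.

Section Count.
Variables (R : realType) (m : nat) (lam : 'I_m.+1 -> R[i]) (B : pred 'I_m.+1) (p : {poly int}).
Local Notation "p ^F" := (map_poly (intr : int -> R[i]) p) (at level 2, format "p ^F").
Hypothesis lam_inj : injective lam.
Hypothesis pB : p^F = \prod_(j | B j) ('X - (lam j)%:P).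

Let rootE z : root p^F z = [exists j, B j && (lam j == z)].
Proof.
rewrite pB rootE horner_prod; apply/prodf_eq0/existsP => [[j Bj]|[j /andP[Bj /eqP <-]]].
  by rewrite !hornerE subr_eq0 eq_sym => jz; exists j; rewrite Bj.
by exists j => //; rewrite !hornerE subrr.
Qed.

Lemma card_real_roots k : has_real_roots R p k ->
  #|[pred j | B j && (complex.Im (lam j) == 0)]| = k.
Proof.
have im0 z : complex.Im z = 0 -> z = ((complex.Re z)%:C)%C :> R[i] by case: z => a b /= ->.
apply: (@card_param _ _ _ _ (fun j => complex.Re (lam j))).
  move=> j j'; rewrite !inE => /andP[_ /eqP/im0 E] /andP[_ /eqP/im0 E'] h.
  by apply: lam_inj; rewrite E E' h.
move=> x /=; rewrite -(mapf_root (real_complex R)) -map_poly_comp.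
have -> : map_poly (real_complex R \o intr) p = p^F.
  by apply: eq_map_poly => a /=; rewrite rmorph_int.
rewrite rootE; split=> [/existsP[j /andP[Bj /eqP jx]]|[j /andP[Bj /eqP/im0 j0] ->]].
  by exists j; rewrite ?jx //= Bj eqxx.
by apply/existsP; exists j; rewrite Bj {1}j0 eqxx.
Qed.

(** A conjugate pair is parametrized by its unique member in the open upper half plane. *)
Lemma card_conj_pairs k : has_conj_pairs R p k ->
  #|[pred j | B j && (0 < complex.Im (lam j))]| = k.
Proof.
apply: (@card_param _ _ _ _ (fun j => [set lam j; conjc (lam j)])).
  move=> j j'; rewrite !inE => /andP[_ j0] /andP[_ j'0] E.
  have : [set lam j'; conjc (lam j')] (lam j) by rewrite -E; left.
  case=> [/lam_inj //|jj']; move: j0; rewrite jj'.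
  by case: (lam j') j'0 => a b /= b0; rewrite oppr_gt0 ltNge ltW.
move=> E /=; split=> [[z [pz z0 ->]]|[j /andP[Bj j0] ->]]; last first.
  exists (lam j); rewrite gt_eqF //; split=> //.
  by rewrite rootE; apply/existsP; exists j; rewrite Bj eqxx.
move: (pz); rewrite rootE => /existsP[j /andP[Bj /eqP jz]].
move: z0; rewrite -{}jz in pz *; rewrite neq_lt => /orP[j0|j0]; last by exists j; rewrite //= Bj.
have : root p^F (conjc (lam j)) by rewrite /root horner_intr_conjc conjc_eq0; exact: pz.
rewrite rootE => /existsP[j' /andP[Bj' /eqP jj']].
exists j'; first by rewrite /= Bj' jj'; case: (lam j) j0 => a b /=; rewrite oppr_gt0.
by rewrite jj' conjcK setUC.
Qed.
End Count.
End Counting.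

(** * The symmetry group *)

(** Over the rationals [p] divides [g], so [g] vanishes at all the roots of [p]. *)
Lemma irreducible_root_transfer (F : numClosedFieldType) (p g : {poly int}) (z z' : F) :
  let toF := map_poly (intr : int -> F) in
  p \is monic -> irreducible_elt p -> root (toF p) z -> root (toF p) z' ->
  root (toF g) z -> root (toF g) z'.
Proof.
move=> toF pm p_irr pz pz' gz.
have := irreducible_root_dvdp pm p_irr pz gz.
have toQ f : map_poly (ratr : rat -> F) (map_poly intr f) = toF f.
  by rewrite -map_poly_comp; apply: eq_map_poly => a /=; rewrite ratr_int.
rewrite -(dvdp_map (ratr : {rmorphism rat -> F})) !toQ => /dvdpP[q ->].
by rewrite rootM pz' orbT.
Qed.

Lemma size_irreducible_monic (p : {poly int}) :
  p \is monic -> irreducible_elt p -> (1 < size p)%N.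
Proof.
move=> pm [p0 pu _]; rewrite ltnNge; apply: contra pu => sp.
have pE := size1_polyC sp; have p01 : p`_0 = 1.
  by rewrite -[LHS]lead_coefC -pE (monicP pm).
by rewrite pE p01 unitr1.
Qed.

Lemma bounded_int_matrices (m N : nat) : exists s : seq 'M[int]_m,
  forall A : 'M[int]_m, (forall i j, `|A i j| <= N%:Z) -> A \in s.
Proof.
pose dec (e : 'I_(N + N).+1) : int := (e : nat)%:Z - N%:Z.
exists [seq map_mx dec A | A : 'M_m] => A AN.
apply/fintype.imageP; exists (\matrix_(i, j) inord (absz (A i j + N%:Z))) => //.
apply/matrixP => i j; rewrite !mxE /dec; have := AN i j; rewrite ler_norml => /andP[h1 h2].
have h : 0 <= A i j + N%:Z by lia.
rewrite inordK; first by rewrite gez0_abs // addrK.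
by rewrite -ltz_nat gez0_abs // -addn1 !PoszD ltzD1 lerD2r.
Qed.

Lemma ln_prod (R : realType) (I : finType) (Q : pred I) (F : I -> R) :
  (forall i, 0 < F i) -> ln (\prod_(i | Q i) F i) = \sum_(i | Q i) ln (F i).
Proof.
move=> F0; suff [] : 0 < \prod_(i | Q i) F i
  /\ ln (\prod_(i | Q i) F i) = \sum_(i | Q i) ln (F i) by [].
apply: (big_rec2 (fun x s => 0 < x /\ ln x = s)) => [|i x s _ [x0 <-]]; first by rewrite ln1.
by split; [exact: mulr_gt0 | rewrite lnM ?posrE].
Qed.

Section Commutant.
Variables (n : nat) (M : GLZ n.+1).
Definition symmx (G : symmetry_group M) : 'M[int]_n.+1 := GLZmx (symval G).

Lemma symmxC G : (M : 'M_n.+1) *m symmx G = symmx G *m M.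
Proof.
have := valP G; rewrite inE => /eqP h.
by have := congr1 (@GLZmx n.+1) h.
Qed.

Lemma symmxM G H : symmx (G * H)%g = symmx G *m symmx H. Proof. by []. Qed.
Lemma symmx1 : symmx 1%g = 1%:M. Proof. by []. Qed.

Lemma symmx_inj : injective symmx.
Proof. by move=> G H GH; apply/val_inj/val_inj. Qed.

Lemma symmetry_of_matrix (A B : 'M[int]_n.+1) :
  (M : 'M_n.+1) *m A = A *m M -> A *m B = 1%:M -> exists G, symmx G = A.
Proof.
move=> MA AB.
have detA : (\det A == 1) || (\det A == -1).
  have : \det A \is a GRing.unit by apply/unitrP; exists (\det B); rewrite mulrC -det_mulmx AB det1.
  by [].
pose G := MkGLZ detA.
have GM : G \in commutes_with M.
  by rewrite inE; apply/eqP/val_inj.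
by exists (MkSymmetry GM).
Qed.
End Commutant.

(** * Eigenvalues of symmetries on the blocks of roots *)

Section Places.
Variables (R : realType) (n l : nat) (M : GLZ n.+1) (P : 'I_l -> {poly int}).
Local Notation C := R[i].
Local Notation I := 'I_n.+1.
Local Notation S := (symmetry_group M).
Local Notation nm := (@modulus R).
Local Notation "p ^F" := (map_poly (intr : int -> C) p) (at level 2, format "p ^F").
Hypothesis P_monic : forall i, P i \is monic.
Hypothesis P_irr : forall i, irreducible_elt (P i).
Hypothesis P_prod : char_poly M = \prod_(i < l) P i.
Variables (lam : I -> C) (chi : 'M[int]_n.+1 -> I -> C) (D : int) (K : R).
Hypotheses (lam_inj : injective lam) (D0 : D != 0) (K0 : 0 <= K).
Hypothesis lamP : (char_poly M)^F = \prod_j ('X - (lam j)%:P).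
Hypothesis chiM : forall G H j, (M : 'M_n.+1) *m G = G *m M ->
  (M : 'M_n.+1) *m H = H *m M -> chi (G *m H) j = chi G j * chi H j.
Hypothesis chi_poly : forall f j, chi (horner_mx M f) j = f^F.[lam j].
Hypothesis chi_denom : forall G : 'M[int]_n.+1, (M : 'M_n.+1) *m G = G *m M ->
  exists g, forall j, D%:~R * chi G j = g^F.[lam j].
Hypothesis chi_inj : forall G H : 'M[int]_n.+1, (M : 'M_n.+1) *m G = G *m M ->
  (M : 'M_n.+1) *m H = H *m M -> chi G =1 chi H -> G = H.
Hypothesis chi_bound : forall (G : 'M[int]_n.+1) i j, (M : 'M_n.+1) *m G = G *m M ->
  `|G i j|%:~R <= K * \sum_k nm (chi G k).

Let DC0 : D%:~R != 0 :> C. Proof. by rewrite intr_eq0. Qed.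

Lemma exists_blocks : exists blk : I -> 'I_l,
  forall i, (P i)^F = \prod_(j | blk j == i) ('X - (lam j)%:P).
Proof.
apply: root_blocks => // [i|]; first by rewrite monic_map.
by rewrite -rmorph_prod /= -P_prod lamP.
Qed.

Variables (blk : I -> 'I_l).
Hypothesis blkP : forall i, (P i)^F = \prod_(j | blk j == i) ('X - (lam j)%:P).

Lemma root_block i z : root (P i)^F z = [exists j, (blk j == i) && (lam j == z)].
Proof.
rewrite blkP rootE horner_prod; apply/prodf_eq0/existsP => [[j Bj]|[j /andP[Bj /eqP <-]]].
  by rewrite !hornerE subr_eq0 eq_sym => jz; exists j; rewrite Bj.
by exists j => //; rewrite !hornerE subrr.
Qed.

Lemma root_block_lam i j : root (P i)^F (lam j) = (blk j == i).
Proof.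
rewrite root_block; apply/existsP/idP => [[j' /andP[ij' /eqP/lam_inj <-]] //|ij].
by exists j; rewrite ij eqxx.
Qed.

Lemma exists_conj : exists cj : I -> I,
  forall j, lam (cj j) = conjc (lam j) /\ blk (cj j) = blk j.
Proof.
suff /choice[f fP] : forall j, exists j', lam j' = conjc (lam j) /\ blk j' = blk j by exists f.
move=> j; have : root (P (blk j))^F (conjc (lam j)).
  by rewrite /root horner_intr_conjc conjc_eq0 -/(root _ _) root_block_lam.
by rewrite root_block => /existsP[j' /andP[/eqP bj' /eqP lj']]; exists j'.
Qed.

Variable cj : I -> I.
Hypothesis cj_lam : forall j, lam (cj j) = conjc (lam j).
Hypothesis cj_blk : forall j, blk (cj j) = blk j.

Implicit Types G H : S.
Let X G j := chi (symmx G) j.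

Lemma eigM G H j : X (G * H)%g j = X G j * X H j.
Proof. by rewrite /X symmxM chiM // symmxC. Qed.

Lemma chi1 j : chi 1%:M j = 1.
Proof. by rewrite -[1%:M](rmorph1 (horner_mx M)) chi_poly rmorph1 hornerC. Qed.

Lemma eig1 j : X 1%g j = 1.
Proof. exact: chi1. Qed.

Lemma eig_neq0 G j : X G j != 0.
Proof.
apply/negP => /eqP G0; have := eig1 j; rewrite -(mulgV G) eigM G0 mul0r => /eqP.
by rewrite eq_sym oner_eq0.
Qed.

Lemma eig_inj G H : X G =1 X H -> G = H.
Proof. by move=> GH; apply/symmx_inj/chi_inj; rewrite ?symmxC. Qed.

Lemma symmetry_mulC G H : (G * H = H * G)%g.
Proof. by apply: eig_inj => j; rewrite !eigM mulrC. Qed.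

Lemma eig_denom G : exists g, forall j, D%:~R * X G j = g^F.[lam j].
Proof. by apply: chi_denom; rewrite symmxC. Qed.

Lemma eig_conj G j : X G (cj j) = conjc (X G j).
Proof.
have [g gP] := eig_denom G; apply: (mulfI DC0).
by rewrite gP cj_lam horner_intr_conjc -gP rmorphM /= rmorph_int.
Qed.

(** The integer polynomial [g - D] represents [D] times [G - 1]; if it vanishes at one root of an
    irreducible factor, it vanishes at all of them. *)
Lemma eig_eq1_block G j j' : blk j = blk j' -> X G j = 1 -> X G j' = 1.
Proof.
move=> jj' Gj; have [g gP] := eig_denom G.
have gD z : (g - D%:P)^F.[z] = g^F.[z] - D%:~R.
  by rewrite rmorphB /= map_polyC hornerD hornerN hornerC.
have := @irreducible_root_transfer _ (P (blk j)) (g - D%:P) (lam j) (lam j') (P_monic _) (P_irr _).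
rewrite /= !root_block_lam jj' eqxx /root !gD -!gP Gj mulr1 subrr eqxx => /(_ isT isT isT).
by rewrite subr_eq0 -{2}[D%:~R]mulr1 (inj_eq (mulfI DC0)) => /eqP.
Qed.

(** * Logarithms of the moduli of the eigenvalues *)

Let ell G j : R := ln (nm (X G j)).

Lemma modulus_eig_gt0 G j : 0 < nm (X G j).
Proof. by rewrite modulus_gt0 eig_neq0. Qed.

Lemma log_eigM G H j : ell (G * H)%g j = ell G j + ell H j.
Proof. by rewrite /ell eigM modulusM lnM ?posrE ?modulus_eig_gt0. Qed.

Lemma log_eig_conj G j : ell G (cj j) = ell G j.
Proof. by rewrite /ell eig_conj modulusJ. Qed.

(** The product over the block of [D] times the eigenvalues is the norm of an integer polynomial,
    thus a nonzero integer of modulus at least 1. Only the powers of [D] enter the constant. *)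
Lemma block_sum_bounded i : exists c, forall G, c <= \sum_(j | blk j == i) ell G j.
Proof.
exists (- \sum_(j | blk j == i) ln (nm D%:~R)) => G.
rewrite -subr_ge0 opprK -big_split /=.
have [g gP] := eig_denom G.
have iseq : (P i)^F = \prod_(z <- [seq lam j | j in [pred j | blk j == i]]) ('X - z%:P).
  by rewrite blkP big_image.
have [N [h [Ng _]]] := norm_poly g (P_monic i) (size_irreducible_monic (P_monic i) (P_irr i)) iseq.
rewrite big_image /= in Ng.
have NE : N%:~R = \prod_(j | blk j == i) (D%:~R * X G j).
  by rewrite Ng; apply: eq_bigr => j _; rewrite gP.
have N1 : 1 <= nm N%:~R.
  rewrite modulus_intr ler1z -gtz0_ge1 normr_gt0 -(intr_eq0 C) NE.
  by apply/prodf_neq0 => j _; rewrite mulf_neq0 ?eig_neq0.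
have -> : \sum_(j | blk j == i) (ell G j + ln (nm D%:~R)) = ln (nm N%:~R).
  rewrite NE modulus_prod ln_prod => [|j]; last by rewrite modulus_gt0 mulf_neq0 ?eig_neq0.
  apply: eq_bigr => j _; rewrite modulusM lnM ?posrE ?modulus_eig_gt0 ?modulus_gt0 //.
  by rewrite addrC.
exact: ln_ge0.
Qed.

(* A morphism from a group to the reals that is bounded below vanishes. *)
Lemma block_sum i G : \sum_(j | blk j == i) ell G j = 0.
Proof.
pose phi G := \sum_(j | blk j == i) ell G j.
have phiM H H' : phi (H * H')%g = phi H + phi H'.
  by rewrite -big_split; apply: eq_bigr => j _; exact: log_eigM.
have phi1 : phi 1%g = 0.
  by apply: (@addrI _ (phi 1%g)); rewrite -phiM mulg1 addr0.
have [c cP] := block_sum_bounded i.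
have phi_ge0 H : 0 <= phi H.
  apply: (@bounded_multiples_ge0 _ _ c) => k.
  have -> : phi H *+ k = phi (H ^+ k)%g.
    by elim: k => [|k IH]; rewrite ?expg0 ?phi1 // mulrS expgS phiM IH.
  exact: cP.
apply/eqP; rewrite eq_le phi_ge0 andbT -oppr_ge0.
suff -> : - phi G = phi G^-1%g by [].
by apply/eqP; rewrite eq_sym -addr_eq0 -phiM mulVg phi1.
Qed.

(* [rep j] is the root of the conjugate pair of [j] in the closed upper half
   plane; these roots stand for the archimedean places. *)
Let rep j := if 0 <= complex.Im (lam j) then j else cj j.

Lemma conj_indexK j : cj (cj j) = j.
Proof. by apply: lam_inj; rewrite !cj_lam conjcK. Qed.

Lemma Im_conj_index j : complex.Im (lam (cj j)) = - complex.Im (lam j).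
Proof. by rewrite cj_lam; case: (lam j). Qed.

Lemma rep_upper j : 0 <= complex.Im (lam (rep j)).
Proof.
rewrite /rep; case: ifPn => //; rewrite -ltNge => j0; by rewrite Im_conj_index oppr_ge0 ltW.
Qed.

Lemma rep_id j : 0 <= complex.Im (lam j) -> rep j = j.
Proof. by rewrite /rep => ->. Qed.

Lemma rep_cj j : rep (cj j) = rep j.
Proof.
rewrite /rep Im_conj_index oppr_ge0.
case: (ltgtP (complex.Im (lam j)) 0) => j0; rewrite ?conj_indexK //.
apply: lam_inj; rewrite cj_lam; case: (lam j) j0 => a b /= ->; by rewrite oppr0.
Qed.

Lemma rep_blk j : blk (rep j) = blk j.
Proof. by rewrite /rep; case: ifP; rewrite ?cj_blk. Qed.

Lemma log_eig_rep G j : ell G (rep j) = ell G j.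
Proof. by rewrite /rep; case: ifP; rewrite ?log_eig_conj. Qed.

Lemma exists_base : exists base : 'I_l -> I,
  forall i, blk (base i) = i /\ 0 <= complex.Im (lam (base i)).
Proof.
suff /choice[f fP] : forall i, exists j, blk j = i /\ 0 <= complex.Im (lam j) by exists f.
move=> i; have [j ji|] := pickP [pred j | blk j == i]; last first.
  move=> none; have := size_irreducible_monic (P_monic i) (P_irr i).
  rewrite -(size_map_inj_poly (@intr_inj C)) // blkP big_pred0; last exact: none.
  by rewrite size_poly1.
by exists (rep j); rewrite rep_blk rep_upper; split=> //; apply/eqP.
Qed.

(** * The logarithmic map on the kept places *)

Variable base : 'I_l -> I.
Hypothesis base_blk : forall i, blk (base i) = i.
Hypothesis base_upper : forall i, 0 <= complex.Im (lam (base i)).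

(* One place per block, [base i], is dropped. *)
Let kept := [pred j | (0 <= complex.Im (lam j)) && (j != base (blk j))].
Let r := #|kept|.
Let L (G : S) : 'rV[R]_r := \row_k ell G (enum_val k).

Lemma rep_kept j : rep j \notin kept -> rep j = base (blk j).
Proof. by rewrite inE rep_upper rep_blk /= negbK => /eqP. Qed.

Lemma log_eigenvaluesM G H : L (G * H)%g = L G + L H.
Proof. by apply/rowP => k; rewrite !mxE log_eigM. Qed.

Lemma log_eigenvalues_kept G B : (forall k, `|L G 0 k| <= B) ->
  forall j, j \in kept -> `|ell G j| <= B.
Proof.
by move=> GB j jk; have := GB (enum_rank_in jk j); rewrite mxE enum_rankK_in.
Qed.

(** The dropped logarithm of a block is recovered from the kept ones, because the block sum is
    zero. *)
Lemma log_eig_bounded G B : 0 <= B -> (forall k, `|L G 0 k| <= B) ->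
  forall j, `|ell G j| <= B *+ n.+1.
Proof.
move=> B0 /log_eigenvalues_kept GB.
have le_mul : B <= B *+ n.+1 by rewrite mulrS lerDl mulrn_wge0.
suff base_le i : `|ell G (base i)| <= B *+ n.+1.
  move=> j; rewrite -log_eig_rep.
  have [jk|/rep_kept ->] := boolP (rep j \in kept); last exact: base_le.
  by rewrite (le_trans (GB _ jk)).
have /eqP := block_sum i G.
(* The terms represented by [base i] are all equal, and there is at least one. *)
rewrite (bigID (fun j => rep j == base i)) /= addr_eq0 => /eqP sumE.
have : `|\sum_(j | (blk j == i) && (rep j != base i)) ell G j| <= B *+ n.+1.
  rewrite (le_trans (ler_norm_sum _ _ _)) //.
  apply: (@le_trans _ _ (\sum_(j : I) B)); last by rewrite sumr_const card_ord.
  rewrite [leLHS]big_mkcond; apply: ler_sum => j _; case: ifP => // /andP[/eqP ji jb].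
  by rewrite -log_eig_rep GB // inE rep_upper rep_blk ji.
apply: le_trans; rewrite -[leRHS]normrN -sumE.
rewrite (eq_bigr (fun=> ell G (base i))) => [|j /andP[_ /eqP <-]]; last by rewrite log_eig_rep.
rewrite sumr_const normrMn; set c := #|_|.
have c0 : (0 < c)%N.
  by apply/card_gt0P; exists (base i); rewrite unfold_in /= base_blk rep_id ?base_upper // !eqxx.
by rewrite -(prednK c0) mulrS lerDl mulrn_wge0.
Qed.

(** Bounded logarithms bound the eigenvalues, hence the integer entries of the matrix. *)
Lemma log_eigenvalues_finite B : exists s : seq S, forall G, (forall k, `|L G 0 k| <= B) -> G \in s.
Proof.
pose B' := `|B| *+ n.+1.
have [s sP] := bounded_int_matrices n.+1 (Num.truncn (K * (expR B' *+ n.+1))).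
(* This prepares a total section of [symmx]; outside the image [1%g] is a mere default value. *)
have mxE' A : exists G : S, (exists G' : S, symmx G' = A) -> symmx G = A.
  by have [[G GA]|nG] := pselect (exists G' : S, symmx G' = A); [exists G | exists 1%g].
have [h hP] := choice mxE'.
exists (map h s) => G GB.
have -> : G = h (symmx G) by apply/symmx_inj/esym/hP; exists G.
apply/map_f/sP => i j.
have nm_le k : nm (X G k) <= expR B'.
  rewrite -[leLHS]lnK ?posrE ?modulus_eig_gt0 // ler_expR (le_trans (ler_norm _)) //.
  by apply: log_eig_bounded => // k'; rewrite (le_trans (GB k')) // ler_norm.
have sum_le : \sum_k nm (X G k) <= expR B' *+ n.+1.
  by rewrite -[in leRHS](card_ord n.+1) -sumr_const; apply: ler_sum.
rewrite -abszE lez_nat truncn_ge_nat; last by rewrite mulr_ge0 // mulrn_wge0 // expR_ge0.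
rewrite (le_trans _ (ler_wpM2l K0 sum_le)) //.
by have := chi_bound i j (symmxC G); rewrite -abszE -pmulrn.
Qed.

(** [unit_small_outside] is applied to the factor of the block of [k], with [out] the roots not
    represented by [k]; evaluating the polynomials at [M] yields mutually inverse matrices. *)
Lemma exists_small_unit k : k \in kept -> exists u : S,
  (forall j, blk j != blk k -> X u j = 1) /\
  (forall j, blk j = blk k -> rep j != k -> nm (X u j) < 1).
Proof.
rewrite inE => /andP[k_upper _].
pose Bk := [pred j | blk j == blk k]; pose d := #|Bk|.
pose lam' (t : 'I_d) := lam (enum_val t).
pose out (t : 'I_d) := rep (enum_val t) != k.
(* [q] vanishes at the roots of the other blocks, where [1 + q * g] is therefore 1, and at none of
   this block. *)
pose q := \prod_(i | i != blk k) P i.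
have kB : k \in Bk by rewrite inE.
have val_rank j (jB : j \in Bk) : enum_val (enum_rank_in kB j : 'I_d) = j by exact: enum_rankK_in.
have q_eval j : q^F.[lam j] = \prod_(i | i != blk k) (P i)^F.[lam j].
  by rewrite rmorph_prod horner_prod.
have [||||g [g' ggP]] := @unit_small_outside R (P (blk k)) q d lam' out (P_monic _) (P_irr _).
- by rewrite blkP big_enum_val.
- move=> t; rewrite q_eval; apply/prodf_neq0 => i ik.
  rewrite -/(root _ _) root_block_lam; have := enum_valP t; rewrite inE => /eqP ->.
  by rewrite eq_sym.
- move=> t ot; have tB : cj (enum_val t) \in Bk.
    by rewrite inE cj_blk; have := enum_valP t; rewrite inE.
  exists (enum_rank_in kB (cj (enum_val t))); last by rewrite /lam' val_rank // cj_lam.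
  by rewrite /out val_rank // rep_cj.
- exists (enum_rank_in kB k); rewrite /out val_rank // rep_id // eqxx //.
pose A := horner_mx M (1 + q * g); pose A' := horner_mx M (1 + q * g').
have MA f : (M : 'M_n.+1) *m horner_mx M f = horner_mx M f *m M.
  by apply: comm_mx_horner.
have chiA_out j f : blk j != blk k -> chi (horner_mx M (1 + q * f)) j = 1.
  move=> jk; rewrite chi_poly rmorphD rmorphM rmorph1 /= hornerD hornerM hornerC q_eval.
  rewrite (bigD1 (blk j)) //= (_ : (P (blk j))^F.[lam j] = 0) ?mul0r ?addr0 //.
  by apply/eqP; rewrite -/(root _ _) root_block_lam.
have chi_in j f : blk j == blk k ->
    exists t : 'I_d, enum_val t = j /\ chi (horner_mx M f) j = f^F.[lam' t].
  move=> jk; have jB : j \in Bk by rewrite inE.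
  by exists (enum_rank_in kB j); rewrite /lam' val_rank // chi_poly.
have AA' : A *m A' = 1%:M.
  apply: chi_inj => [||j]; rewrite ?mulmx1 ?mul1mx //.
    by rewrite mulmxA MA -!mulmxA MA.
  rewrite chiM ?MA // chi1; have [jk|jk] := boolP (blk j == blk k); last first.
    by rewrite !chiA_out // mulr1.
  rewrite !chi_poly; have [t [<- _]] := chi_in j 1 jk.
  by have [] := ggP t.
have [u uA] := symmetry_of_matrix (MA _) AA'.
exists u; split=> j jk; rewrite /X uA; first exact: chiA_out.
have [|t [tj ->]] := chi_in j (1 + q * g); first by rewrite jk.
by move=> jk'; have [_] := ggP t; apply; rewrite /out tj.
Qed.

(** Off-diagonal logarithms are nonpositive. As all logarithms sum to zero, the weighted row sum is
    the opposite of the contribution of the dropped places, which is negative. *)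
Lemma exists_independent : exists u : 'I_r -> S, (\matrix_i L (u i)) \in unitmx.
Proof.
suff /choice[u uP] : forall i : 'I_r, exists u : S,
    (forall j, blk j != blk (enum_val i) -> X u j = 1) /\
    (forall j, blk j = blk (enum_val i) -> rep j != enum_val i -> nm (X u j) < 1);
  last by move=> i; apply/exists_small_unit/enum_valP.
exists u.
(* The weight counts the roots that a place stands for: one if real, two otherwise. *)
pose w j : R := #|[pred j' | rep j' == j]|%:R.
have upper (i : 'I_r) : 0 <= complex.Im (lam (enum_val i)).
  by have := enum_valP i; rewrite inE => /andP[].
have ell_out i j : blk j != blk (enum_val i) -> ell (u i) j = 0.
  by move=> ij; rewrite /ell (uP i).1 // modulus1 ln1.
have ell_lt0 i j : blk j = blk (enum_val i) -> rep j != enum_val i -> ell (u i) j < 0.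
  by move=> ij jr; apply: ln_lt0; rewrite modulus_eig_gt0 (uP i).2.
have ell_le0 i j : rep j != enum_val i -> ell (u i) j <= 0.
  move=> jr; have [ij|ij] := eqVneq (blk j) (blk (enum_val i)); last by rewrite ell_out.
  by rewrite ltW // ell_lt0.
apply: (@zmatrix_unit _ _ _ (fun i => w (enum_val i))) => [i|i j ij|i].
- by rewrite ltr0n; apply/card_gt0P; exists (enum_val i); rewrite inE rep_id.
- rewrite !mxE ell_le0 // rep_id //; apply: contra ij => /eqP/enum_val_inj ->.
  by rewrite eqxx.
under eq_bigr => k _ do rewrite !mxE.
rewrite (_ : \sum_j _ = \sum_(j in kept) ell (u i) j * w j); last by rewrite [RHS]big_enum_val.
have total : \sum_j ell (u i) j = 0.
  rewrite (partition_big blk xpredT) //= big1 // => b _; exact: block_sum.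
have -> : \sum_(j in kept) ell (u i) j * w j = \sum_(j | rep j \in kept) ell (u i) j.
  rewrite [RHS](partition_big rep (mem kept)) //=; apply: eq_bigr => j jk.
  rewrite (eq_bigl [pred j' | rep j' == j]) => [|j']; last first.
    by rewrite /= andb_idl // => /eqP ->.
  rewrite (eq_bigr (fun=> ell (u i) j)) => [|j' /eqP <-]; last by rewrite log_eig_rep.
  by rewrite sumr_const /w mulr_natr.
have := total; rewrite (bigID (fun j => rep j \in kept)) /= => /eqP.
rewrite addr_eq0 => /eqP ->; rewrite oppr_gt0.
(* The dropped place of the block of the unit makes the inequality strict. *)
pose b := base (blk (enum_val i)).
have rb : rep b = b by rewrite rep_id ?base_upper.
have bk : rep b \notin kept by rewrite rb inE base_upper base_blk eqxx.
have neq j : rep j \notin kept -> rep j != enum_val i.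
  by apply: contraNneq => ->; apply: enum_valP.
rewrite (bigD1 b) //= -[ltRHS]addr0 ltr_leD //.
  by rewrite ell_lt0 ?base_blk // neq.
by apply: sumr_le0 => j /andP[jk _]; apply/ell_le0/neq.
Qed.

(** A block has [n1 i + n2 i] roots in the closed upper half plane, and [base i] is removed from
    them. *)
Lemma card_kept (n1 n2 : 'I_l -> nat) :
  (forall i, has_real_roots R (P i) (n1 i)) ->
  (forall i, has_conj_pairs R (P i) (n2 i)) ->
  r%:Z = \sum_(i < l) ((n1 i)%:Z + (n2 i)%:Z - 1).
Proof.
move=> real_roots conj_pairs.
have block_card i : (#|[pred j | (j \in kept) && (blk j == i)]|.+1 = n1 i + n2 i)%N.
  rewrite -(card_real_roots lam_inj (blkP i) (real_roots i)).
  rewrite -(card_conj_pairs lam_inj (blkP i) (conj_pairs i)).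
  pose U := [pred j | (blk j == i) && (0 <= complex.Im (lam j))].
  have -> : #|[pred j | (j \in kept) && (blk j == i)]|.+1 = #|U|.
    have bU : base i \in U by rewrite inE base_blk eqxx base_upper.
    rewrite (cardD1 (base i) U) bU add1n; congr _.+1; apply: eq_card => j.
    by rewrite !inE; case: (eqVneq (blk j) i) => [->|_]; rewrite ?andbT ?andbF //= andbC.
  rewrite -cardUI [X in (_ + X)%N]eq_card0 ?addn0 => [|j]; last first.
    by rewrite !inE; case: ltgtP; rewrite ?andbF.
  by apply: eq_card => j; rewrite !inE le_eqVlt [0 == _]eq_sym andb_orr.
have -> : r = (\sum_(i < l) #|[pred j | (j \in kept) && (blk j == i)]|)%N.
  rewrite /r -sum1_card (partition_big blk xpredT) //=; apply: eq_bigr => i _.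
  by rewrite -sum1_card; apply: eq_bigl => j; rewrite !inE.
rewrite (big_morph Posz PoszD (erefl _)); apply: eq_bigr => i _.
by rewrite -PoszD -block_card [in RHS]intS [RHS]addrC addKr.
Qed.

(** * The finite part and the final assembly *)

Lemma torsion_structure (T : finZmodType) (io : T -> S) :
  injective io -> (forall a b, io (a + b) = (io a * io b)%g) ->
  (forall G, L G = 0 <-> exists t, G = io t) ->
  ~~ odd #|T| /\ generated_by_at_most T l.
Proof.
move=> io_inj ioD ioP.
have io0 : io 0 = 1%g.
  by apply: (@mulgI _ (io 0)); rewrite -ioD addr0 mulg1.
split.
  have [||G GE] := @symmetry_of_matrix n M (- 1%:M) (- 1%:M).
  - by rewrite mulmxN mulNmx mulmx1 mul1mx.
  - by rewrite mulmxN mulNmx mulmx1 opprK.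
  have GG : (G * G = 1)%g.
    by apply: symmx_inj; rewrite symmxM GE mulmxN mulNmx mulmx1 opprK.
  have L1 : L 1%g = 0 by apply/ioP; exists 0.
  (* The square of [- 1] is 1, so twice its logarithm vector is zero. *)
  have /ioP[t Gt] : L G = 0.
    have := log_eigenvaluesM G G; rewrite GG L1 => /esym/rowP LG; apply/rowP => k.
    by have := LG k; rewrite !mxE; lra.
  have t2 : t *+ 2 = 0 by apply: io_inj; rewrite mulr2n ioD -Gt GG io0.
  apply/negP => oddT.
  have t0 : t *+ #|T| = 0.
    rewrite -FinRing.zmodXgE -cardsT; apply: (@expg_cardG T [set: T]%G t); exact: finset.in_setT.
  have {}t0 : t = 0.
    by move: t0; rewrite -[#|T|]odd_double_half oddT add1n mulrS -mul2n mulrnA t2 mul0rn addr0.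
  move: GE; rewrite Gt t0 io0 symmx1 => /matrixP/(_ ord0 ord0).
  by rewrite !mxE eqxx.
(* The eigenvalues at the [base i] separate the elements of [T]: being 1 at [base i] forces 1 on the
   whole block. *)
have [|i|i t t' _ _|t _ ht|A [Al AT]] := @generated_by_characters T C l
    (fun i t => X (io t) (base i)) [set: T]%G.
- exact: FinRing.zmod_abelian.
- by rewrite -[1%g]/(0 : T) io0 eig1.
- by rewrite -[(t * t')%g]/(t + t') ioD eigM.
- apply: io_inj; rewrite -[1%g]/(0 : T) io0; apply: eig_inj => j; rewrite eig1.
  by apply: eig_eq1_block (ht (blk j)); rewrite base_blk.
by exists A; split; rewrite // AT.
Qed.

Lemma symmetry_structure (n1 n2 : 'I_l -> nat) :
  (forall i, has_real_roots R (P i) (n1 i)) ->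
  (forall i, has_conj_pairs R (P i) (n2 i)) ->
  [/\ forall G H : S, (G * H = H * G)%g, finitely_generated S
    & exists (T : finZmodType) (r : nat),
        [/\ add_mul_isomorphic (T * 'rV[int]_r)%type S,
            ~~ odd #|T|, generated_by_at_most T l
          & r%:Z = \sum_(i < l) ((n1 i)%:Z + (n2 i)%:Z - 1)]].
Proof.
move=> real_roots conj_pairs; have [u u_free] := exists_independent.
have [fg [T [io [isoT io_inj ioD ioP]]]] :=
  log_structure symmetry_mulC log_eigenvaluesM log_eigenvalues_finite u_free.
have [evenT genT] := torsion_structure io_inj ioD ioP.
split=> //; first exact: symmetry_mulC.
by exists T, r; split=> //; exact: card_kept.
Qed.
End Places.

Theorem theorem1 (R : realType) (n : nat) (M : GLZ n) (l : nat)
    (P : 'I_l -> {poly int}) (n1 n2 : 'I_l -> nat) :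
  (2 <= n)%N ->
  simple_mx R M ->
  (forall i, P i \is monic /\ irreducible_elt (P i)) ->
  char_poly M = \prod_(i < l) P i ->
  (forall i, has_real_roots R (P i) (n1 i)) ->
  (forall i, has_conj_pairs R (P i) (n2 i)) ->
  [/\ forall G H : symmetry_group M, (G * H = H * G)%g,
      finitely_generated (symmetry_group M)
    & exists (T : finZmodType) (r : nat),
        [/\ add_mul_isomorphic (T * 'rV[int]_r)%type (symmetry_group M),
            ~~ odd #|T|,
            generated_by_at_most T l
          & r%:Z = \sum_(i < l) ((n1 i)%:Z + (n2 i)%:Z - 1)]].
Proof.
case: n M => [//|n] M _ simpleM P_ok P_prod real_roots conj_pairs.
have P_monic i : P i \is monic by case: (P_ok i).
have P_irr i : irreducible_elt (P i) by case: (P_ok i).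
have [lam [chi [D [K [[lam_inj lamP D0 K0] [chiM chi_poly chi_denom chi_inj chi_bound]]]]]] :=
  spectral_character simpleM.
have [blk blkP] := exists_blocks P_monic P_prod lam_inj lamP.
have [cj cjP] := exists_conj lam_inj blkP.
have [base baseP] := exists_base P_monic P_irr blkP (fun j => (cjP j).1) (fun j => (cjP j).2).
exact: (symmetry_structure P_monic P_irr lam_inj D0 K0 chiM chi_poly chi_denom chi_inj chi_bound
  blkP (fun j => (cjP j).1) (fun j => (cjP j).2) (fun i => (baseP i).1) (fun i => (baseP i).2)
  real_roots conj_pairs).
Qed.
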